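(* Let $f=H+|z|^2G+|z|^4K$ be a triharmonic (i.e. $3$-harmonic) mapping of the unit disk $\mathbb{D}$ such that $B_f<\infty$, where $H$, $G$ and $K$ are harmonic in $\mathbb{D}$. Then $$B_f\ge\sup_{z\in\mathbb{D}}(1-|z|^2)\Big|\,\big|H_z+|z|^2G_z+|z|^4K_z\big|-\big|H_{\overline z}+|z|^2G_{\overline z}+|z|^4K_{\overline z}\big|\,\Big|.$$ Furthermore, if $M>0$ is a constant such that $|H(z)|\le M$, $|G(z)|\le M$ and $|K(z)|\le M$ for all $z\in\mathbb{D}$, then $$B_f\le 2M\phi_3(y_1)\approx4.037006\,M,$$ where $\phi_3(y_1)=\sup_{0<y<1}\phi_3(y)$ and $$\phi_3(y)=\frac2\pi(1+y^2+y^4)+y(1+y^2-2y^4).$$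
   Context: $\mathbb{D}=\{z\in\mathbb{C}:|z|<1\}$. Harmonic means complex-valued with $\Delta u=0$, and $3$-harmonic means six times continuously differentiable, complex-valued, with $\Delta^3f=0$, where $\Delta=4\frac{\partial^2}{\partial z\partial\overline z}$. The Bloch constant of $f$ is $$B_f=\sup_{z,w\in\mathbb{D},\,z\ne w}\frac{|f(z)-f(w)|}{\rho(z,w)},\qquad \rho(z,w)=\frac12\log\left(\frac{1+\left|\frac{z-w}{1-\overline zw}\right|}{1-\left|\frac{z-w}{1-\overline zw}\right|}\right).$$ *)

(* Defs.v *)
(* Stdlib real numbers with Coquelicot.  Complex functions are total functions
   [C -> C]; only their values on the open unit disk matter below. *)
From Stdlib Require Import Reals.
From Coquelicot Require Import Coquelicot.
Open Scope R_scope.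

Definition unit_disk (z : C) : Prop := Cmod z < 1.

(* [d_x f] and [d_y f] are the partial derivatives of [f] in the real and the
   imaginary part of the variable, taken componentwise.  They are meaningful
   where these derivatives exist, e.g. under [Cn_on_disk n f] with [0 < n]. *)
Definition d_x (f : C -> C) (z : C) : C :=
  (Derive (fun t => Re (f (t, Im z))) (Re z),
   Derive (fun t => Im (f (t, Im z))) (Re z)).

Definition d_y (f : C -> C) (z : C) : C :=
  (Derive (fun t => Re (f (Re z, t))) (Im z),
   Derive (fun t => Im (f (Re z, t))) (Im z)).

Definition d_z (f : C -> C) (z : C) : C :=
  (RtoC (/ 2) * (d_x f z - Ci * d_y f z))%C.

Definition d_zbar (f : C -> C) (z : C) : C :=
  (RtoC (/ 2) * (d_x f z + Ci * d_y f z))%C.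

Definition laplacian (f : C -> C) (z : C) : C :=
  (RtoC 4 * d_z (d_zbar f) z)%C.

(* [ex_diff_n g n x y] asks for continuity at [(x, y)] of [g] and of all its
   iterated partial derivatives of order at most [n]; required at every point
   of the disk, which is open, it says that [g] is of class C^n there. *)
Definition Cn_on_disk (n : nat) (f : C -> C) : Prop :=
  forall z, unit_disk z ->
    ex_diff_n (fun x y => Re (f (x, y))) n (Re z) (Im z) /\
    ex_diff_n (fun x y => Im (f (x, y))) n (Re z) (Im z).

Definition polyharmonic (p : nat) (f : C -> C) : Prop :=
  Cn_on_disk (2 * p) f /\
  forall z, unit_disk z -> Nat.iter p laplacian f z = RtoC 0.

Definition harmonic (f : C -> C) : Prop := polyharmonic 1 f.

Definition triharmonic (f : C -> C) : Prop := polyharmonic 3 f.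

Definition rho (z w : C) : R :=
  let d := Cmod ((z - w) / (1 - Cconj z * w))%C in
  1 / 2 * ln ((1 + d) / (1 - d)).

Definition bloch_constant (f : C -> C) : Rbar :=
  Lub_Rbar (fun r => exists z w : C,
    unit_disk z /\ unit_disk w /\ z <> w /\ r = Cmod (f z - f w)%C / rho z w).

Definition phi3 (y : R) : R :=
  2 / PI * (1 + y ^ 2 + y ^ 4) + y * (1 + y ^ 2 - 2 * y ^ 4).

(* Main.v *)
(* Everything is done for the real functions [Re (conj e * F)], [|e| = 1].

   A real harmonic [u] with [|u| <= M] on the disk satisfies
   [(1 - |z|^2) |grad u(z)| <= 4 M / PI]: transport [u] by [zeta |-> exp zeta] and a
   Moebius map to the strip [|y| < PI / 2], with [0] going to [z].  There
   [u(x, y) - u(x, - y)] vanishes for [y = 0] and is at most [2 M], so by the maximum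
   principle on long rectangles it is at most [(4 M / PI) y].  Together with the product
   rule for [h + |z|^2 g + |z|^4 k] this bounds the hyperbolic gradient of each component
   of [f] by [2 M phi3 |z|]; integrating along hyperbolic geodesics gives the upper bound.

   For the lower bound, differentiate [f] at [z] in the direction [d], [|d| = 1],
   orthogonal to [z].  Then [|z|^2] is stationary, so the derivative is
   [d A + conj d B] with [A = H_z + |z|^2 G_z + |z|^4 K_z] and
   [B = H_zbar + |z|^2 G_zbar + |z|^4 K_zbar], of modulus at least [| |A| - |B| |]. *)
Require Import Defs.
From Stdlib Require Import Reals Lra Psatz ClassicalEpsilon.
From Coquelicot Require Import Coquelicot.
Open Scope R_scope.

(** * The maximum of phi3 *)

(** Partial sums of the alternating series behind PI / 4 = 2 atan (1/3) + atan (1/7) bracket PI /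
    4. *)
Lemma PI_bounds : 3.1415926 < PI < 3.1415927.
Proof.
  destruct (PI_2_3_7_ineq 4) as [Hl Hu].
  unfold PI_2_3_7_tg, tg_alt, Ratan_seq in Hl, Hu; simpl in Hl, Hu.
  split; lra.
Qed.

(** With [c] a decimal close to [/ PI], all but the last summand is a polynomial with rational
    coefficients; the sign of [/ PI - c] fixes the direction of the estimate. *)
Lemma phi3_approx (c y : R) :
  phi3 y = 2 * c * (1 + y ^ 2 + y ^ 4) + y * (1 + y ^ 2 - 2 * y ^ 4)
           + 2 * (/ PI - c) * (1 + y ^ 2 + y ^ 4).
Proof. unfold phi3, Rdiv. ring. Qed.

Lemma inv_PI_bounds : 0.318309881 < / PI < 0.318309892.
Proof.
  destruct PI_bounds as [Hl Hu].
  split.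
  - apply Rlt_trans with (/ 3.1415927).
    + lra.
    + apply Rinv_lt_contravar; nra.
  - apply Rlt_trans with (/ 3.1415926).
    + apply Rinv_lt_contravar; nra.
    + lra.
Qed.

Lemma phi3_gt : 2.0185025 < phi3 0.891951.
Proof.
  (* The point 0.891951 approximates the maximiser; this [c] lies below [/ PI], so the error term is
     positive. *)
  rewrite (phi3_approx 0.318309881). destruct inv_PI_bounds. nra.
Qed.

Lemma phi3_lt (y : R) : 0 <= y <= 1 -> phi3 y < 2.0185035.
Proof.
  intros [H0 H1]. rewrite (phi3_approx 0.318309892). destruct inv_PI_bounds as [_ H].
  assert (H2 : 2 * (/ PI - 0.318309892) * (1 + y ^ 2 + y ^ 4) <= 0) by nra.
  (* The coefficients below come from dividing the polynomial by [e ^ 2]. *)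
  set (e := y - 0.891951).
  assert (H3 : 0 <= e ^ 2 * (2 * y ^ 3 + 2.931184216 * y ^ 2 + 2.637792212488832 * y)).
  { apply Rmult_le_pos; [apply pow2_ge_0|].
    assert (0 <= y ^ 2) by nra. assert (0 <= y ^ 3) by (apply pow_le; lra). lra. }
  (* The remainder of the division; its linear term is tiny because 0.891951 is nearly a critical
     point, so completing the square shows positivity. *)
  assert (H4 : 0 < 1.736961486765480935848000 * e ^ 2
    + 0.000003346116908769525545264000 * e + 8.10221435832104084913567016000E-7).
  { pose proof (pow2_ge_0 e). pose proof (pow2_ge_0 (e + 0.000001)). lra. }
  unfold e in H3, H4. lra.
Qed.

(** Continuity gives a maximum on [0, 1]; the end point values 2 / PI and 6 / PI stay below the
    value at 0.891951. *)
Lemma phi3_max :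
  exists y1, 0 < y1 < 1 /\ forall y, 0 <= y <= 1 -> phi3 y <= phi3 y1.
Proof.
  destruct (continuity_ab_maj phi3 0 1) as [y1 [H1 H2]].
  - lra.
  - intros c _. apply derivable_continuous_pt.
    apply ex_derive_Reals_0. unfold phi3. auto_derive. exact I.
  - exists y1. split; [|exact H1].
    assert (H4 := Rlt_le_trans _ _ _ phi3_gt (H1 0.891951 ltac:(lra))).
    destruct inv_PI_bounds as [_ H].
    split; apply Rnot_le_lt; intro H5.
    + replace y1 with 0 in H4 by lra. unfold phi3, Rdiv in H4. lra.
    + replace y1 with 1 in H4 by lra. unfold phi3, Rdiv in H4. lra.
Qed.

(** * A maximum principle *)

(** At the interior maximum [g' x = 0]; were [l > 0], then [g'] would be positive just to the right
    of [x], and by the mean value theorem [g] would exceed [g x] there. *)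
Lemma second_derivative_at_max (g g' : R -> R) (a b x l : R) :
  a < x < b ->
  (forall t, a < t < b -> is_derive g t (g' t)) ->
  is_derive g' x l ->
  (forall t, a < t < b -> g t <= g x) ->
  l <= 0.
Proof.
  intros Hx Hg Hg' Hmax.
  assert (Hg'0 : g' x = 0).
  { assert (Hd : derivable_pt_lim g x (g' x)) by (apply is_derive_Reals, Hg, Hx).
    rewrite <- (deriv_maximum g a b x (exist _ (g' x) Hd)); try easy.
    intros t Ht1 Ht2. apply Hmax. lra. }
  apply Rnot_lt_le. intro Hl.
  apply is_derive_Reals in Hg'.
  destruct (Hg' (l / 2) ltac:(lra)) as [[d Hd] Hlim]. simpl in Hlim.
  set (t := x + Rmin (d / 2) ((b - x) / 2)).
  assert (Ht : x < t < b /\ t - x < d).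
  { unfold t. assert (A := Rmin_l (d / 2) ((b - x) / 2)).
    assert (B := Rmin_r (d / 2) ((b - x) / 2)).
    assert (0 < Rmin (d / 2) ((b - x) / 2)) by (apply Rmin_glb_lt; lra). lra. }
  destruct Ht as [[Ht1 Ht2] Ht3].
  destruct (MVT_cor2 g g' x t Ht1) as [c [Hc [Hc1 Hc2]]].
  { intros s Hs. apply is_derive_Reals, Hg. lra. }
  assert (Hgt := Hmax t ltac:(lra)).
  specialize (Hlim (c - x) ltac:(lra)).
  rewrite Rabs_pos_eq in Hlim by lra.
  specialize (Hlim ltac:(lra)).
  apply Rabs_def2 in Hlim as [_ Hlim].
  replace (x + (c - x)) with c in Hlim by ring.
  rewrite Hg'0, Rminus_0_r in Hlim.
  assert (0 < g' c / (c - x)) by lra.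
  assert (0 < g' c).
  { replace (g' c) with (g' c / (c - x) * (c - x)) by (field; lra).
    apply Rmult_lt_0_compat; lra. }
  nra.
Qed.

Lemma continuity_2d_pt_slice (f : R -> R -> R) (x y : R) :
  continuity_2d_pt f x y -> continuity_pt (f x) y.
Proof.
  intro H. apply continuity_pt_locally. intro eps.
  destruct (H eps) as [d Hd]. exists d. intros t Ht. apply Hd.
  - rewrite Rminus_diag, Rabs_R0. apply cond_pos.
  - exact Ht.
Qed.

(** Maximise in [y] for each fixed [x], then in [x]; uniform continuity makes the slice maximum
    continuous in [x]. *)
Lemma rectangle_max (f : R -> R -> R) (a b c d : R) :
  a <= b -> c <= d ->
  (forall x y, a <= x <= b -> c <= y <= d -> continuity_2d_pt f x y) ->
  exists x0 y0, a <= x0 <= b /\ c <= y0 <= d /\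
    forall x y, a <= x <= b -> c <= y <= d -> f x y <= f x0 y0.
Proof.
  intros Hab Hcd Hf.
  (* Clamping to [a, b] extends the slices to all real [x]: the one-variable maximum theorem wants
     two-sided continuity, also at the end points. *)
  set (cl := fun x => Rmax a (Rmin b x)).
  assert (Hcl : forall x, a <= cl x <= b).
  { intro x. unfold cl. split; [apply Rmax_l|].
    apply Rmax_lub; [lra | apply Rmin_l]. }
  assert (Hclid : forall x, a <= x <= b -> cl x = x).
  { intros x Hx. unfold cl. rewrite Rmin_right, Rmax_right; lra. }
  assert (Hcl1 : forall x x', Rabs (cl x - cl x') <= Rabs (x - x')).
  { intros x x'. unfold cl, Rmax, Rmin.
    repeat (destruct (Rle_dec _ _)); unfold Rabs; repeat (destruct (Rcase_abs _)); lra. }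
  destruct (constructive_indefinite_description
    (fun Y : R -> R => forall x, c <= Y x <= d /\
       forall y, c <= y <= d -> f (cl x) y <= f (cl x) (Y x))) as [Y HY].
  { assert (HE : forall x, exists y0, c <= y0 <= d /\
       forall y, c <= y <= d -> f (cl x) y <= f (cl x) y0).
    { intro x. destruct (continuity_ab_maj (f (cl x)) c d Hcd) as [y0 [H1 H2]].
      - intros y Hy. apply continuity_2d_pt_slice, Hf; auto.
      - exists y0; auto. }
    exists (fun x => proj1_sig (constructive_indefinite_description _ (HE x))).
    intro x. exact (proj2_sig (constructive_indefinite_description _ (HE x))). }
  destruct (continuity_ab_maj (fun x => f (cl x) (Y x)) a b Hab) as [x0 [H1 H2]].
  { intros x Hx. apply continuity_pt_locally. intro eps.
    destruct (uniform_continuity_2d f a b c d Hf eps) as [dl Hdl].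
    exists dl. intros x' Hx'.
    (* Slices that are uniformly within [eps] of each other have maxima within [eps]. *)
    assert (Hu : forall y, c <= y <= d -> Rabs (f (cl x') y - f (cl x) y) < eps).
    { intros y Hy. apply Hdl; auto.
      - apply Rle_lt_trans with (1 := Hcl1 x' x). exact Hx'.
      - rewrite Rminus_diag, Rabs_R0. apply cond_pos. }
    destruct (HY x) as [Hy Hm]. destruct (HY x') as [Hy' Hm'].
    assert (A1 := Hm _ Hy'). assert (A2 := Hm' _ Hy).
    assert (B1 := Hu _ Hy). assert (B2 := Hu _ Hy').
    apply Rabs_def2 in B1. apply Rabs_def2 in B2.
    apply Rabs_def1; lra. }
  exists x0, (Y x0). destruct (HY x0) as [Hy Hm].
  split; [exact H2|]. split; [exact Hy|].
  intros x y Hx Hy'. specialize (H1 x Hx). simpl in H1.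
  rewrite (Hclid x0 H2), (Hclid x Hx) in H1.
  apply Rle_trans with (2 := H1). destruct (HY x) as [_ Hmx].
  rewrite (Hclid x Hx) in Hmx. auto.
Qed.

(** At an interior maximum both pure second derivatives are at most zero, against the positive
    Laplacian; hence the maximum sits on the boundary. *)
Lemma maximum_principle_rectangle (w wx wy wxx wyy : R -> R -> R) (a b c d : R) :
  (forall x y, a <= x <= b -> c <= y <= d -> continuity_2d_pt w x y) ->
  (forall x y, a < x < b -> c < y < d ->
     is_derive (fun t => w t y) x (wx x y) /\
     is_derive (fun t => wx t y) x (wxx x y) /\
     is_derive (fun t => w x t) y (wy x y) /\
     is_derive (fun t => wy x t) y (wyy x y) /\
     0 < wxx x y + wyy x y) ->
  (forall x y, a <= x <= b -> c <= y <= d ->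
     x = a \/ x = b \/ y = c \/ y = d -> w x y <= 0) ->
  forall x y, a <= x <= b -> c <= y <= d -> w x y <= 0.
Proof.
  intros Hc Hd Hb x y Hx Hy.
  destruct (rectangle_max w a b c d) as [x0 [y0 [Hx0 [Hy0 Hm]]]]; try easy; try lra.
  apply Rle_trans with (1 := Hm x y Hx Hy).
  destruct (Req_dec x0 a) as [?|N1]; [apply Hb; auto|].
  destruct (Req_dec x0 b) as [?|N2]; [apply Hb; auto|].
  destruct (Req_dec y0 c) as [?|N3]; [apply Hb; auto|].
  destruct (Req_dec y0 d) as [?|N4]; [apply Hb; auto|].
  exfalso.
  assert (A : wxx x0 y0 <= 0).
  { apply (second_derivative_at_max (fun t => w t y0) (fun t => wx t y0) a b x0).
    - lra.
    - intros t Ht. apply Hd; lra.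
    - apply Hd; lra.
    - intros t Ht. apply Hm; lra. }
  assert (B : wyy x0 y0 <= 0).
  { apply (second_derivative_at_max (fun t => w x0 t) (fun t => wy x0 t) c d y0).
    - lra.
    - intros t Ht. apply Hd; lra.
    - apply Hd; lra.
    - intros t Ht. apply Hm; lra. }
  assert (C := Hd x0 y0 ltac:(lra) ltac:(lra)). lra.
Qed.

(** * Harmonic and holomorphic functions *)

Lemma differentiable_pt_lim_fst (x y : R) :
  differentiable_pt_lim (fun u _ => u) x y 1 0.
Proof. apply differentiable_pt_lim_proj1_0, derivable_pt_lim_id. Qed.

Lemma differentiable_pt_lim_snd (x y : R) :
  differentiable_pt_lim (fun _ v => v) x y 0 1.
Proof.
  intros eps. exists eps. intros u v _ _.
  replace (v - y - (0 * (u - x) + 1 * (v - y))) with 0 by ring.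
  rewrite Rabs_R0. apply Rmult_le_pos; [apply Rlt_le, cond_pos|].
  apply Rle_trans with (2 := Rmax_l _ _). apply Rabs_pos.
Qed.

Lemma differentiable_pt_lim_const (c x y : R) :
  differentiable_pt_lim (fun _ _ => c) x y 0 0.
Proof. apply (differentiable_pt_lim_proj1_0 (fun _ => c)), derivable_pt_lim_const. Qed.

Lemma differentiable_pt_lim_plus (f g : R -> R -> R) (x y fx fy gx gy : R) :
  differentiable_pt_lim f x y fx fy -> differentiable_pt_lim g x y gx gy ->
  differentiable_pt_lim (fun u v => f u v + g u v) x y (fx + gx) (fy + gy).
Proof.
  intros Hf Hg.
  replace (fx + gx) with (1 * fx + 1 * gx) by ring.
  replace (fy + gy) with (1 * fy + 1 * gy) by ring.
  apply (differentiable_pt_lim_comp Rplus); try assumption.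
  intros eps. exists eps. intros u v _ _.
  match goal with |- Rabs ?e <= _ => replace e with 0 by ring end.
  rewrite Rabs_R0. apply Rmult_le_pos; [apply Rlt_le, cond_pos|].
  apply Rle_trans with (2 := Rmax_l _ _). apply Rabs_pos.
Qed.

Lemma differentiable_pt_lim_mult (f g : R -> R -> R) (x y fx fy gx gy : R) :
  differentiable_pt_lim f x y fx fy -> differentiable_pt_lim g x y gx gy ->
  differentiable_pt_lim (fun u v => f u v * g u v) x y
    (fx * g x y + f x y * gx) (fy * g x y + f x y * gy).
Proof.
  intros Hf Hg.
  replace (fx * g x y) with (g x y * fx) by ring.
  replace (fy * g x y) with (g x y * fy) by ring.
  apply (differentiable_pt_lim_comp Rmult); try assumption.
  intros eps. exists eps. intros u v Hu _.
  (* The remainder of the linearised product is the product of the two increments. *)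
  match goal with |- Rabs ?e <= _ =>
    replace e with ((u - f x y) * (v - g x y)) by ring end.
  rewrite Rabs_mult. apply Rmult_le_compat; try apply Rabs_pos.
  - now apply Rlt_le.
  - apply Rmax_r.
Qed.

Lemma differentiable_pt_lim_comp_1d (g : R -> R) (f : R -> R -> R) (x y l fx fy : R) :
  derivable_pt_lim g (f x y) l -> differentiable_pt_lim f x y fx fy ->
  differentiable_pt_lim (fun u v => g (f u v)) x y (l * fx) (l * fy).
Proof.
  intros Hg Hf.
  replace (l * fx) with (l * fx + 0 * 0) by ring.
  replace (l * fy) with (l * fy + 0 * 0) by ring.
  apply (differentiable_pt_lim_comp (fun s _ => g s) f (fun _ _ => 0)).
  - now apply differentiable_pt_lim_proj1_0.
  - exact Hf.
  - apply differentiable_pt_lim_const.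
Qed.

Lemma differentiable_pt_lim_partial_x (f : R -> R -> R) (x y fx fy : R) :
  differentiable_pt_lim f x y fx fy -> is_derive (fun t => f t y) x fx.
Proof.
  intro H. apply is_derive_Reals.
  replace fx with (fx * 1 + fy * 0) by ring.
  apply (derivable_pt_lim_comp_2d f (fun t => t) (fun _ => y)); trivial.
  - apply derivable_pt_lim_id.
  - apply derivable_pt_lim_const.
Qed.

Lemma differentiable_pt_lim_partial_y (f : R -> R -> R) (x y fx fy : R) :
  differentiable_pt_lim f x y fx fy -> is_derive (fun t => f x t) y fy.
Proof.
  intro H. apply is_derive_Reals.
  replace fy with (fx * 0 + fy * 1) by ring.
  apply (derivable_pt_lim_comp_2d f (fun _ => x) (fun t => t)); trivial.
  - apply derivable_pt_lim_const.
  - apply derivable_pt_lim_id.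
Qed.

Lemma differentiable_pt_lim_eq (f : R -> R -> R) (x y a b a' b' : R) :
  differentiable_pt_lim f x y a b -> a = a' -> b = b' ->
  differentiable_pt_lim f x y a' b'.
Proof. now intros H <- <-. Qed.

Lemma differentiable_pt_lim_continuity_2d (f : R -> R -> R) (x y a b : R) :
  differentiable_pt_lim f x y a b -> continuity_2d_pt f x y.
Proof. intro H. apply differentiable_continuity_pt. now exists a, b. Qed.

Lemma differentiable_pt_lim_conj (f : R -> R -> R) (x y a b : R) :
  differentiable_pt_lim f x (- y) a b ->
  differentiable_pt_lim (fun u v => f u (- v)) x y a (- b).
Proof.
  intro H. eapply differentiable_pt_lim_eq.
  - apply (differentiable_pt_lim_comp f (fun u _ => u) (fun _ v => - v) x y a b 1 0
      (-1 * 0) (-1 * 1) H).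
    + apply differentiable_pt_lim_fst.
    + apply (differentiable_pt_lim_comp_1d Ropp (fun _ v => v)).
      * apply is_derive_Reals. auto_derive; [exact I | ring].
      * apply differentiable_pt_lim_snd.
  - ring.
  - ring.
Qed.

(* The second condition says that [ux - i uy] satisfies the Cauchy-Riemann
   equations, which subsumes the symmetry of the mixed derivatives. *)
Definition harmonic_on (D : R -> R -> Prop) (u ux uy : R -> R -> R) : Prop :=
  forall x y, D x y ->
    differentiable_pt_lim u x y (ux x y) (uy x y) /\
    exists a b, differentiable_pt_lim ux x y a b /\
                differentiable_pt_lim uy x y b (- a).

(* [p + i q] is holomorphic with derivative [c + i s], which is itself holomorphic. *)
Definition holomorphic_on (D : R -> R -> Prop) (p q c s : R -> R -> R) : Prop :=
  forall x y, D x y ->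
    differentiable_pt_lim p x y (c x y) (- s x y) /\
    differentiable_pt_lim q x y (s x y) (c x y) /\
    exists e k, differentiable_pt_lim c x y e (- k) /\
                differentiable_pt_lim s x y k e.

(** The conjugate gradient of the composite is [ux - i uy] at [p + i q] times [c + i s], a product
    of holomorphic functions. The factor [- 1] keeps the formula within sums and products. *)
Lemma harmonic_on_comp (D E : R -> R -> Prop) (u ux uy p q c s : R -> R -> R) :
  harmonic_on E u ux uy -> holomorphic_on D p q c s ->
  (forall x y, D x y -> E (p x y) (q x y)) ->
  harmonic_on D (fun x y => u (p x y) (q x y))
    (fun x y => ux (p x y) (q x y) * c x y + uy (p x y) (q x y) * s x y)
    (fun x y => uy (p x y) (q x y) * c x y + - 1 * (ux (p x y) (q x y) * s x y)).
Proof.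
  intros Hu Hp HE x y HD.
  destruct (Hu _ _ (HE x y HD)) as [Hu1 [a [b [Hux Huy]]]].
  destruct (Hp x y HD) as [Hp1 [Hq1 [e [k [Hc Hs]]]]].
  assert (Hux' := differentiable_pt_lim_comp _ p q x y _ _ _ _ _ _ Hux Hp1 Hq1).
  assert (Huy' := differentiable_pt_lim_comp _ p q x y _ _ _ _ _ _ Huy Hp1 Hq1).
  split.
  - eapply differentiable_pt_lim_eq.
    + exact (differentiable_pt_lim_comp _ p q x y _ _ _ _ _ _ Hu1 Hp1 Hq1).
    + ring.
    + ring.
  - do 2 eexists; split; eapply differentiable_pt_lim_eq.
    + apply differentiable_pt_lim_plus; apply differentiable_pt_lim_mult; eassumption.
    + reflexivity.
    + reflexivity.
    + apply differentiable_pt_lim_plus.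
      * apply differentiable_pt_lim_mult; eassumption.
      * apply differentiable_pt_lim_mult; [apply differentiable_pt_lim_const|].
        apply differentiable_pt_lim_mult; eassumption.
    + cbv beta. ring.
    + cbv beta. ring.
Qed.

(** One-sided, because the later comparisons with the strip majorant and with the hyperbolic
    distance are made for positive increments only. *)
Lemma right_derivative_le_0 (g : R -> R) (x l d : R) :
  0 < d -> is_derive g x l -> (forall t, 0 < t < d -> g (x + t) <= g x) -> l <= 0.
Proof.
  intros Hd Hg H. apply is_derive_Reals in Hg.
  apply Rnot_lt_le. intro Hl.
  destruct (Hg l Hl) as [[d' Hd'] Hlim]. simpl in Hlim.
  set (t := Rmin d d' / 2).
  assert (Ht : 0 < t < d /\ t < d').
  { unfold t. assert (A := Rmin_l d d'). assert (B := Rmin_r d d').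
    assert (0 < Rmin d d') by (apply Rmin_glb_lt; lra). lra. }
  specialize (Hlim t ltac:(lra)). rewrite Rabs_pos_eq in Hlim by lra.
  specialize (Hlim ltac:(lra)). apply Rabs_def2 in Hlim as [_ Hlim].
  specialize (H t ltac:(lra)).
  assert (0 < (g (x + t) - g x) / t) by lra.
  assert (0 < (g (x + t) - g x) / t * t) by (apply Rmult_lt_0_compat; lra).
  replace ((g (x + t) - g x) / t * t) with (g (x + t) - g x) in H1 by (field; lra).
  lra.
Qed.

(** * The Schwarz lemma for harmonic functions *)

Lemma is_derive_minus_minus (f g p : R -> R) (x lf lg lp : R) :
  is_derive f x lf -> is_derive g x lg -> is_derive p x lp ->
  is_derive (fun t => f t - g t - p t) x (lf - lg - lp).
Proof. intros Hf Hg Hp. repeat (apply @is_derive_minus; trivial). Qed.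

Lemma is_derive_reflect (f : R -> R) (x l : R) :
  is_derive f (- x) l -> is_derive (fun t => f (- t)) x (- l).
Proof.
  intro H. replace (- l) with (scal (- 1) l) by (unfold scal; simpl; unfold mult; simpl; ring).
  apply (is_derive_comp f Ropp); [exact H|]. auto_derive; reflexivity.
Qed.

Definition strip (x y : R) : Prop := - (PI / 2) < y < PI / 2.

(* The odd part in [y] vanishes on the real axis and is at most [2 M] on the line
   [y = h]; the barrier [eps (x^2 + 2 h^2 - 2 y^2)] is superharmonic and absorbs
   the ends of the long rectangle. *)
Lemma strip_odd_part_le (u ux uy : R -> R -> R) (M h y : R) :
  harmonic_on strip u ux uy ->
  (forall x y, strip x y -> Rabs (u x y) <= M) ->
  0 <= y <= h -> 0 < h < PI / 2 ->
  u 0 y - u 0 (- y) <= 2 * M / h * y.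
Proof.
  intros Hu HM Hy Hh.
  assert (M0 : 0 <= M).
  { apply Rle_trans with (2 := HM 0 0 ltac:(unfold strip; lra)). apply Rabs_pos. }
  apply le_epsilon. intros eps0 Heps0.
  (* Makes the barrier at most [eps0] at [x = 0]. *)
  set (eps := eps0 / (2 * h ^ 2)).
  assert (Hh2 : 0 < h ^ 2) by (apply pow_lt; lra).
  assert (Heps : 0 < eps) by (apply Rdiv_lt_0_compat; lra).
  (* At the ends the barrier has to absorb 2 M; (1 + A)^2 >= A with A = 2 M / eps suffices. *)
  set (L := 1 + 2 * M / eps).
  assert (HL0 : 0 <= 2 * M / eps) by (apply Rdiv_le_0_compat; lra).
  assert (HL : 1 <= L) by (unfold L; lra).
  assert (HL2 : 2 * M <= eps * L ^ 2).
  { replace (2 * M) with (eps * (2 * M / eps)) by (field; lra).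
    apply Rmult_le_compat_l; [lra|]. unfold L in *. nra. }
  set (k := 2 * M / h).
  assert (Hk : k * h = 2 * M) by (unfold k; field; lra).
  assert (Hk0 : 0 <= k) by (apply Rdiv_le_0_compat; lra).
  (* The maximum principle takes second derivatives as functions, whereas [harmonic_on] only asserts
     their existence at each point. *)
  set (a := fun x y => Derive (fun t => ux t y) x).
  assert (Hstrip : forall x y, 0 <= y <= h -> strip x y /\ strip x (- y))
    by (unfold strip; intros; lra).
  assert (Hp : forall x y, strip x y ->
    is_derive (fun t => u t y) x (ux x y) /\ is_derive (fun t => ux t y) x (a x y) /\
    is_derive (fun t => u x t) y (uy x y) /\ is_derive (fun t => uy x t) y (- a x y)).
  { intros x' y' Hs. destruct (Hu _ _ Hs) as [H1 [a' [b' [H2 H3]]]].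
    assert (Ha : a x' y' = a').
    { apply is_derive_unique. eapply differentiable_pt_lim_partial_x; eassumption. }
    rewrite Ha. split; [|split; [|split]].
    - exact (differentiable_pt_lim_partial_x _ _ _ _ _ H1).
    - exact (differentiable_pt_lim_partial_x _ _ _ _ _ H2).
    - exact (differentiable_pt_lim_partial_y _ _ _ _ _ H1).
    - exact (differentiable_pt_lim_partial_y _ _ _ _ _ H3). }
  set (w := fun x y => u x y - u x (- y) - (k * y + eps * (x ^ 2 + 2 * h ^ 2 - 2 * y ^ 2))).
  assert (Hw : w 0 y <= 0).
  { apply (maximum_principle_rectangle w
      (fun x y => ux x y - ux x (- y) - eps * (2 * x))
      (fun x y => uy x y - - uy x (- y) - (k - eps * (4 * y)))
      (fun x y => a x y - a x (- y) - eps * 2)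
      (fun x y => - a x y - - - - a x (- y) - - (eps * 4)) (- L) L 0 h); try lra.
    - intros x' y' _ Hy'. destruct (Hstrip x' y' Hy') as [S1 S2].
      eapply differentiable_pt_lim_continuity_2d. unfold w, Rminus.
      apply (differentiable_pt_lim_plus (fun x y => u x y + - u x (- y))).
      + apply differentiable_pt_lim_plus; [apply Hu, S1|].
        apply (differentiable_pt_lim_comp_1d Ropp (fun x y => u x (- y))).
        * apply is_derive_Reals. auto_derive; reflexivity.
        * apply differentiable_pt_lim_conj, Hu, S2.
      + apply (differentiable_pt_lim_comp_1d Ropp
          (fun x y => k * y + eps * (x ^ 2 + 2 * h ^ 2 + - (2 * y ^ 2)))).
        * apply is_derive_Reals. auto_derive; reflexivity.
        * apply differentiable_pt_lim_plus.
          -- apply (differentiable_pt_lim_comp_1d (fun t => k * t) (fun _ y => y)).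
             ++ apply is_derive_Reals. auto_derive; reflexivity.
             ++ apply differentiable_pt_lim_snd.
          -- apply (differentiable_pt_lim_comp_1d (fun t => eps * t)
               (fun x y => x ^ 2 + 2 * h ^ 2 + - (2 * y ^ 2))).
             ++ apply is_derive_Reals. auto_derive; reflexivity.
             ++ apply (differentiable_pt_lim_plus (fun x _ => x ^ 2 + 2 * h ^ 2)).
                ** apply (differentiable_pt_lim_comp_1d (fun t => t ^ 2 + 2 * h ^ 2) (fun x _ => x)).
                   --- apply is_derive_Reals. auto_derive; reflexivity.
                   --- apply differentiable_pt_lim_fst.
                ** apply (differentiable_pt_lim_comp_1d (fun t => - (2 * t ^ 2)) (fun _ y => y)).
                   --- apply is_derive_Reals. auto_derive; reflexivity.
                   --- apply differentiable_pt_lim_snd.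
    - intros x' y' _ Hy'. destruct (Hstrip x' y' ltac:(lra)) as [S1 S2].
      destruct (Hp _ _ S1) as [A1 [A2 [A3 A4]]].
      destruct (Hp _ _ S2) as [B1 [B2 [B3 B4]]].
      split; [|split; [|split; [|split]]].
      + apply (is_derive_minus_minus (fun t => u t y') (fun t => u t (- y'))); trivial.
        auto_derive; [exact I | ring].
      + apply (is_derive_minus_minus (fun t => ux t y') (fun t => ux t (- y'))); trivial.
        auto_derive; [exact I | ring].
      + apply (is_derive_minus_minus (fun t => u x' t) (fun t => u x' (- t))); trivial.
        * now apply is_derive_reflect.
        * auto_derive; [exact I | ring].
      + apply (is_derive_minus_minus (fun t => uy x' t) (fun t => - uy x' (- t))); trivial.
        * apply (is_derive_opp (fun t => uy x' (- t))). now apply is_derive_reflect.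
        * auto_derive; [exact I | ring].
      (* The harmonic contributions cancel and leave - 2 eps + 4 eps = 2 eps. *)
      + simpl; lra.
    - intros x' y' Hx' Hy' Hb. destruct (Hstrip x' y' Hy') as [S1 S2].
      assert (A := proj1 (Rabs_le_between _ _) (HM _ _ S1)).
      assert (B := proj1 (Rabs_le_between _ _) (HM _ _ S2)).
      unfold w.
      assert (0 <= y' ^ 2 <= h ^ 2) by (split; [apply pow2_ge_0 | apply pow_incr; lra]).
      assert (0 <= eps * (2 * h ^ 2 - 2 * y' ^ 2)) by (apply Rmult_le_pos; lra).
      assert (0 <= k * y') by (apply Rmult_le_pos; lra).
      assert (0 <= eps * x' ^ 2) by (apply Rmult_le_pos; [lra | apply pow2_ge_0]).
      (* On the vertical sides the barrier outweighs 2 M; on [y = 0] the odd part vanishes; on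
         [y = h] the linear term equals 2 M. *)
      destruct Hb as [-> | [-> | [-> | ->]]].
      + replace ((- L) ^ 2) with (L ^ 2) by ring. lra.
      + lra.
      + rewrite Ropp_0. lra.
      + lra. }
  unfold w in Hw.
  assert (eps * (2 * h ^ 2) = eps0) by (unfold eps; field; lra).
  assert (0 <= eps * y ^ 2) by (apply Rmult_le_pos; [lra | apply pow2_ge_0]).
  fold k. lra.
Qed.

(** Comparing derivatives at [y = 0] in the odd-part estimate gives [h * uy 0 0 <= M]; then [h]
    tends to PI / 2. *)
Lemma strip_derivative_le (u ux uy : R -> R -> R) (M : R) :
  harmonic_on strip u ux uy ->
  (forall x y, strip x y -> Rabs (u x y) <= M) ->
  uy 0 0 <= 2 * M / PI.
Proof.
  intros Hu HM. assert (HPI := PI_RGT_0).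
  assert (S0 : strip 0 0) by (unfold strip; lra).
  assert (M0 : 0 <= M).
  { apply Rle_trans with (2 := HM 0 0 S0). apply Rabs_pos. }
  assert (H : forall h, 0 < h < PI / 2 -> h * uy 0 0 <= M).
  { intros h Hh.
    assert (Hd : is_derive (fun t => u 0 t) 0 (uy 0 0)).
    { eapply differentiable_pt_lim_partial_y. apply Hu, S0. }
    assert (2 * uy 0 0 - 2 * M / h <= 0).
    { apply (right_derivative_le_0 (fun t => u 0 t - u 0 (- t) - 2 * M / h * t) 0 _ h).
      - lra.
      - replace (2 * uy 0 0 - 2 * M / h) with (uy 0 0 - - uy 0 0 - 2 * M / h) by ring.
        apply (is_derive_minus_minus (fun t => u 0 t) (fun t => u 0 (- t))); trivial.
        + apply is_derive_reflect. now rewrite Ropp_0.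
        + auto_derive; [exact I | ring].
      - intros t Ht. rewrite Rplus_0_l, Ropp_0.
        assert (A := strip_odd_part_le u ux uy M h t Hu HM ltac:(lra) Hh). lra. }
    replace M with (h * (M / h)) by (field; lra).
    apply Rmult_le_compat_l; lra. }
  assert (PI / 2 * uy 0 0 <= M).
  { apply Rnot_lt_le. intro HN.
    assert (HU : 0 < uy 0 0) by nra.
    assert (HMU : M / uy 0 0 < PI / 2) by (apply Rlt_div_l; lra).
    assert (0 <= M / uy 0 0) by (apply Rdiv_le_0_compat; lra).
    (* Any [h] strictly between [M / uy 0 0] and PI / 2 contradicts [H]; the midpoint is one. *)
    assert (A := H ((M / uy 0 0 + PI / 2) / 2) ltac:(lra)).
    assert (M / uy 0 0 * uy 0 0 = M) by (field; lra). nra. }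
  apply Rmult_le_reg_l with (PI / 2); [lra|].
  replace (PI / 2 * (2 * M / PI)) with M by (field; lra). assumption.
Qed.

(** * Conformal transport from the strip to the half-plane and the disk *)

Definition disk (x y : R) : Prop := x ^ 2 + y ^ 2 < 1.

(** The map w |-> a w + b with a = a1 + i a2 and b = b1 + i b2. *)
Lemma holomorphic_on_affine (D : R -> R -> Prop) (a1 a2 b1 b2 : R) :
  holomorphic_on D (fun x y => a1 * x + - a2 * y + b1) (fun x y => a2 * x + a1 * y + b2)
    (fun _ _ => a1) (fun _ _ => a2).
Proof.
  assert (H : forall a b c x y,
    differentiable_pt_lim (fun x y => a * x + b * y + c) x y a b).
  { intros a b c x y. eapply differentiable_pt_lim_eq.
    - apply differentiable_pt_lim_plus; [|apply differentiable_pt_lim_const].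
      apply differentiable_pt_lim_plus; apply differentiable_pt_lim_mult;
        (apply differentiable_pt_lim_fst || apply differentiable_pt_lim_snd ||
         apply differentiable_pt_lim_const).
    - cbv beta; ring.
    - cbv beta; ring. }
  intros x y _. split; [|split]; [apply H | apply H |].
  exists 0, 0. split; [|apply differentiable_pt_lim_const].
  rewrite Ropp_0. apply differentiable_pt_lim_const.
Qed.

(** The map w |-> 1 / w with derivative - 1 / w^2, in real coordinates. *)
Lemma holomorphic_on_inv :
  holomorphic_on (fun x y => 0 < x ^ 2 + y ^ 2)
    (fun x y => x * / (x ^ 2 + y ^ 2)) (fun x y => - 1 * y * / (x ^ 2 + y ^ 2))
    (fun x y => (y ^ 2 + - 1 * x ^ 2) * / ((x ^ 2 + y ^ 2) ^ 2))
    (fun x y => 2 * x * y * / ((x ^ 2 + y ^ 2) ^ 2)).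
Proof.
  intros x y HN.
  assert (Hsq : forall f fx fy, differentiable_pt_lim f x y fx fy ->
    differentiable_pt_lim (fun x y => f x y ^ 2) x y (2 * f x y * fx) (2 * f x y * fy)).
  { intros f fx fy H. apply (differentiable_pt_lim_comp_1d (fun t => t ^ 2)); trivial.
    apply is_derive_Reals. auto_derive; trivial. ring. }
  assert (Hinv : forall f fx fy, f x y <> 0 -> differentiable_pt_lim f x y fx fy ->
    differentiable_pt_lim (fun x y => / f x y) x y (- / (f x y ^ 2) * fx) (- / (f x y ^ 2) * fy)).
  { intros f fx fy H0 H. apply (differentiable_pt_lim_comp_1d Rinv); trivial.
    apply is_derive_Reals. auto_derive; trivial. field; trivial. }
  assert (N0 : x ^ 2 + y ^ 2 <> 0) by lra.
  assert (N2 : (x ^ 2 + y ^ 2) ^ 2 <> 0) by now apply pow_nonzero.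
  assert (HD := differentiable_pt_lim_plus _ _ _ _ _ _ _ _
    (Hsq _ _ _ (differentiable_pt_lim_fst x y))
    (Hsq _ _ _ (differentiable_pt_lim_snd x y))).
  assert (HDi := Hinv _ _ _ N0 HD).
  assert (HD2i := Hinv _ _ _ N2 (Hsq _ _ _ HD)).
  split; [|split].
  - eapply differentiable_pt_lim_eq.
    + apply differentiable_pt_lim_mult; [apply differentiable_pt_lim_fst | exact HDi].
    + cbv beta; field; trivial.
    + cbv beta; field; trivial.
  - eapply differentiable_pt_lim_eq.
    + apply differentiable_pt_lim_mult; [|exact HDi].
      apply differentiable_pt_lim_mult;
        [apply differentiable_pt_lim_const | apply differentiable_pt_lim_snd].
    + cbv beta; field; trivial.
    + cbv beta; field; trivial.
  (* Real and imaginary parts of the second derivative 2 / w^3. *)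
  - exists (2 * (x ^ 3 - 3 * x * y ^ 2) / (x ^ 2 + y ^ 2) ^ 3),
      (2 * (y ^ 3 - 3 * x ^ 2 * y) / (x ^ 2 + y ^ 2) ^ 3).
    split; eapply differentiable_pt_lim_eq.
    + apply differentiable_pt_lim_mult; [|exact HD2i].
      apply differentiable_pt_lim_plus; [exact (Hsq _ _ _ (differentiable_pt_lim_snd x y))|].
      apply differentiable_pt_lim_mult;
        [apply differentiable_pt_lim_const | exact (Hsq _ _ _ (differentiable_pt_lim_fst x y))].
    + cbv beta; field; trivial.
    + cbv beta; field; trivial.
    + apply differentiable_pt_lim_mult; [|exact HD2i].
      apply differentiable_pt_lim_mult; [|apply differentiable_pt_lim_snd].
      apply differentiable_pt_lim_mult;
        [apply differentiable_pt_lim_const | apply differentiable_pt_lim_fst].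
    + cbv beta; field; trivial.
    + cbv beta; field; trivial.
Qed.

Lemma holomorphic_on_exp (D : R -> R -> Prop) :
  holomorphic_on D (fun x y => exp x * cos y) (fun x y => exp x * sin y)
    (fun x y => exp x * cos y) (fun x y => exp x * sin y).
Proof.
  intros x y _.
  assert (He : differentiable_pt_lim (fun x y => exp x) x y (exp x) 0).
  { apply (differentiable_pt_lim_proj1_0 exp), derivable_pt_lim_exp. }
  assert (Hc : differentiable_pt_lim (fun x y => cos y) x y (- sin y * 0) (- sin y * 1)).
  { apply (differentiable_pt_lim_comp_1d cos (fun _ v => v));
    [apply derivable_pt_lim_cos | apply differentiable_pt_lim_snd]. }
  assert (Hs : differentiable_pt_lim (fun x y => sin y) x y (cos y * 0) (cos y * 1)).
  { apply (differentiable_pt_lim_comp_1d sin (fun _ v => v));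
    [apply derivable_pt_lim_sin | apply differentiable_pt_lim_snd]. }
  assert (Hp : differentiable_pt_lim (fun x y => exp x * cos y) x y
    (exp x * cos y) (- (exp x * sin y))).
  { eapply differentiable_pt_lim_eq; [apply differentiable_pt_lim_mult; eassumption | cbv beta; ring | cbv beta; ring]. }
  assert (Hq : differentiable_pt_lim (fun x y => exp x * sin y) x y
    (exp x * sin y) (exp x * cos y)).
  { eapply differentiable_pt_lim_eq; [apply differentiable_pt_lim_mult; eassumption | cbv beta; ring | cbv beta; ring]. }
  split; [|split]; [exact Hp | exact Hq |].
  exists (exp x * cos y), (exp x * sin y). now split.
Qed.

Lemma holomorphic_on_subset (D E : R -> R -> Prop) (p q c s : R -> R -> R) :
  holomorphic_on E p q c s -> (forall x y, D x y -> E x y) -> holomorphic_on D p q c s.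
Proof. intros H HD x y Hxy. now apply H, HD. Qed.

Definition half_plane (x y : R) : Prop := 0 < x.

(** The exponential maps the strip into the half-plane and 0 to 1 with derivative 1, so the bound is
    unchanged. *)
Lemma half_plane_derivative_le (u ux uy : R -> R -> R) (M : R) :
  harmonic_on half_plane u ux uy ->
  (forall x y, half_plane x y -> Rabs (u x y) <= M) ->
  uy 1 0 <= 2 * M / PI.
Proof.
  intros Hu HM.
  assert (HE : forall x y, strip x y -> half_plane (exp x * cos y) (exp x * sin y)).
  { intros x y [H1 H2]. apply Rmult_lt_0_compat; [apply exp_pos | apply cos_gt_0; lra]. }
  assert (H := strip_derivative_le _ _ _ M
    (harmonic_on_comp _ _ _ _ _ _ _ _ _ Hu (holomorphic_on_exp strip) HE)
    (fun x y Hs => HM _ _ (HE x y Hs))).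
  cbv beta in H. rewrite exp_0, cos_0, sin_0 in H.
  replace (1 * 1) with 1 in H by ring. replace (1 * 0) with 0 in H by ring. lra.
Qed.

(* The Moebius map [w |-> d' (w - b) / (w + conj b)] of the half-plane onto the disk,
   written as [d' - 2 (Re b) d' / (w + conj b)], where [d' = (z0 + d) / (1 + conj z0 d)]
   and [conj b = (1 - conj z0 d) / (1 + conj z0 d)] are chosen so that [1] goes to
   [z0] with derivative [d (1 - |z0|^2) / 2]; here [d = - i e]. *)
Lemma disk_derivative_le (u ux uy : R -> R -> R) (M x0 y0 e1 e2 : R) :
  harmonic_on disk u ux uy ->
  (forall x y, disk x y -> Rabs (u x y) <= M) ->
  disk x0 y0 -> e1 ^ 2 + e2 ^ 2 = 1 ->
  (1 - (x0 ^ 2 + y0 ^ 2)) * (ux x0 y0 * e1 + uy x0 y0 * e2) <= 4 * M / PI.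
Proof.
  intros Hu HM Hz He. unfold disk in Hz.
  pose (d1 := e2). pose (d2 := - e1).
  assert (Hd : d1 ^ 2 = 1 - d2 ^ 2) by (unfold d1, d2; lra).
  (* N = |z0 + d|^2 = |1 + conj z0 d|^2 because |d| = 1; it is nonzero because |z0| < 1. *)
  set (N := (x0 + d1) ^ 2 + (y0 + d2) ^ 2).
  assert (HN : 0 < N).
  { assert (0 <= N) by (apply Rplus_le_le_0_compat; apply pow2_ge_0).
    destruct (Req_dec N 0) as [H0|]; [|lra]. exfalso.
    assert (Hx := pow2_ge_0 (x0 + d1)). assert (Hy := pow2_ge_0 (y0 + d2)).
    assert (Ex : x0 + d1 = 0) by (apply Rsqr_0_uniq; rewrite Rsqr_pow2; unfold N in H0; lra).
    assert (Ey : y0 + d2 = 0) by (apply Rsqr_0_uniq; rewrite Rsqr_pow2; unfold N in H0; lra).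
    replace x0 with (- d1) in Hz by lra. replace y0 with (- d2) in Hz by lra. nra. }
  (* a1 + i a2 is d' and b1 + i b2 is b, with the denominators made real. *)
  set (a1 := (2 * x0 + d1 + (x0 ^ 2 - y0 ^ 2) * d1 + 2 * x0 * y0 * d2) / N).
  set (a2 := (2 * y0 + d2 + 2 * x0 * y0 * d1 - (x0 ^ 2 - y0 ^ 2) * d2) / N).
  set (b1 := (1 - (x0 ^ 2 + y0 ^ 2)) / N).
  set (b2 := 2 * (x0 * d2 - y0 * d1) / N).
  assert (Hb1 : 0 < b1) by (apply Rdiv_lt_0_compat; lra).
  assert (Ha : a1 ^ 2 + a2 ^ 2 = 1).
  { unfold a1, a2. field_simplify_eq; [|lra]. unfold N. ring [Hd]. }
  (* The image of the half-plane under w |-> w + conj b. *)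
  set (HB := fun x y : R => b1 < x).
  assert (HE1 : forall x y, HB x y ->
    disk ((-2 * b1 * a1) * (x * / (x ^ 2 + y ^ 2)) + - (-2 * b1 * a2) * (- 1 * y * / (x ^ 2 + y ^ 2)) + a1)
     ((-2 * b1 * a2) * (x * / (x ^ 2 + y ^ 2)) + (-2 * b1 * a1) * (- 1 * y * / (x ^ 2 + y ^ 2)) + a2)).
  { intros x y Hx. unfold HB in Hx. unfold disk.
    assert (Hm : 0 < x ^ 2 + y ^ 2) by nra.
    apply Rlt_0_minus.
    match goal with |- 0 < ?g =>
      replace g with (4 * b1 * (x - b1) / (x ^ 2 + y ^ 2)) end.
    - apply Rdiv_lt_0_compat; nra.
    - assert (Ha' : a1 ^ 2 = 1 - a2 ^ 2) by lra. field_simplify_eq; [|lra]. ring [Ha']. }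
  assert (HBpos : forall x y, HB x y -> 0 < x ^ 2 + y ^ 2) by (unfold HB; intros; nra).
  assert (HAB := harmonic_on_comp HB _ _ _ _ _ _ _ _
    (harmonic_on_comp (fun x y => disk ((-2 * b1 * a1) * x + - (-2 * b1 * a2) * y + a1)
       ((-2 * b1 * a2) * x + (-2 * b1 * a1) * y + a2)) disk u ux uy _ _ _ _ Hu
      (holomorphic_on_affine _ (-2 * b1 * a1) (-2 * b1 * a2) a1 a2) (fun x y H => H))
    (holomorphic_on_subset HB _ _ _ _ _ holomorphic_on_inv HBpos) HE1).
  assert (HE2 : forall x y, half_plane x y -> HB (1 * x + - 0 * y + b1) (0 * x + 1 * y + - b2)).
  { intros x y Hx. unfold HB, half_plane in *. lra. }
  assert (HABC := harmonic_on_comp half_plane _ _ _ _ _ _ _ _ HAB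
    (holomorphic_on_affine half_plane 1 0 b1 (- b2)) HE2).
  assert (H := half_plane_derivative_le _ _ _ M HABC
    (fun x y Hx => HM _ _ (HE1 _ _ (HE2 x y Hx)))).
  cbv beta in H.
  replace (1 * 1 + - 0 * 0 + b1) with (1 + b1) in H by ring.
  replace (0 * 1 + 1 * 0 + - b2) with (- b2) in H by ring.
  set (m := (1 + b1) ^ 2 + (- b2) ^ 2) in H.
  (* Here m = |1 + conj b|^2, and 1 + conj b = 2 / (1 + conj z0 d). *)
  assert (Em : m = 4 / N).
  { unfold m, b1, b2. field_simplify_eq; [|lra]. unfold N. ring [Hd]. }
  rewrite Em in H.
  (* The arguments of [ux] are the coordinates of the image of 1, which is z0. *)
  match type of H with context [ux ?X ?Y] =>
    replace X with x0 in H; [replace Y with y0 in H|] end.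
  (* The direction i at 1 is carried to i d (1 - |z0|^2) / 2 = e (1 - |z0|^2) / 2, whence the factor
     2. *)
  - match type of H with ?g <= _ =>
      replace ((1 - (x0 ^ 2 + y0 ^ 2)) * (ux x0 y0 * e1 + uy x0 y0 * e2)) with (2 * g) end.
    { replace (4 * M / PI) with (2 * (2 * M / PI)) by (unfold Rdiv; ring).
      apply Rmult_le_compat_l; [lra | exact H]. }
    generalize (ux x0 y0) (uy x0 y0). intros U V.
    replace e1 with (- d2) by (unfold d2; ring). replace e2 with d1 by reflexivity.
    unfold a1, a2, b1, b2. field_simplify_eq; [|lra]. unfold N. ring [Hd].
  - unfold a1, a2, b1, b2. field_simplify_eq; [|lra]. unfold N. ring [Hd].
  - unfold a1, a2, b1, b2. field_simplify_eq; [|lra]. unfold N. ring [Hd].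
Qed.

(** * Real and imaginary parts of complex harmonic functions *)

Lemma C1_differentiable_pt_lim (f : R -> R -> R) (x y : R) :
  locally_2d (fun u v => ex_derive (fun t => f t v) u) x y ->
  ex_derive (fun t => f x t) y ->
  continuity_2d_pt (fun u v => Derive (fun t => f t v) u) x y ->
  differentiable_pt_lim f x y (Derive (fun t => f t y) x) (Derive (fun t => f x t) y).
Proof.
  intros Hx Hy Hc. apply filterdiff_differentiable_pt_lim.
  apply (is_derive_filterdiff f x y (fun u v => Derive (fun t => f t v) u)).
  - apply locally_2d_locally in Hx. revert Hx. apply filter_imp.
    intros [u v] Huv. now apply Derive_correct.
  - now apply Derive_correct.
  - now apply continuity_2d_pt_filterlim in Hc.
Qed.

Lemma disk_unit_disk (x y : R) : disk x y <-> unit_disk (x, y).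
Proof.
  unfold disk, unit_disk, Cmod; simpl fst; simpl snd. split; intro H.
  - rewrite <- sqrt_1. apply sqrt_lt_1_alt. split; [nra | exact H].
  - apply sqrt_lt_0_alt. now rewrite sqrt_1.
Qed.

Lemma disk_open (x y : R) : disk x y -> locally_2d disk x y.
Proof.
  intro H.
  assert (Hc : continuity_2d_pt (fun u v => u * u + v * v) x y).
  { apply continuity_2d_pt_plus; apply continuity_2d_pt_mult;
    apply continuity_2d_pt_id1 || apply continuity_2d_pt_id2. }
  unfold disk in *.
  assert (He : 0 < 1 - (x ^ 2 + y ^ 2)) by lra.
  destruct (Hc (mkposreal _ He)) as [d Hd]. exists d. intros u v Hu Hv.
  assert (A := Hd u v Hu Hv). simpl in A. apply Rabs_def2 in A. simpl in *. lra.
Qed.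

Definition C2_on_disk (f : R -> R -> R) : Prop :=
  forall x y, disk x y -> ex_diff_n f 2 x y.

Lemma locally_2d_disk (P : R -> R -> Prop) (x y : R) :
  (forall u v, disk u v -> P u v) -> disk x y -> locally_2d P x y.
Proof.
  intros HP H. apply disk_open in H. revert H. apply locally_2d_impl.
  apply locally_2d_forall. exact HP.
Qed.

Definition partial_x (f : R -> R -> R) (x y : R) : R := Derive (fun t => f t y) x.
Definition partial_y (f : R -> R -> R) (x y : R) : R := Derive (fun t => f x t) y.

(** By the symmetry theorem of Schwarz both mixed derivatives are written [partial_y (partial_x f)],
    as suits the Cauchy-Riemann clause of [harmonic_on]. *)
Lemma C2_on_disk_differentiable (f : R -> R -> R) (x y : R) :
  C2_on_disk f -> disk x y ->
  differentiable_pt_lim f x y (partial_x f x y) (partial_y f x y) /\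
  differentiable_pt_lim (partial_x f) x y
    (partial_x (partial_x f) x y) (partial_y (partial_x f) x y) /\
  differentiable_pt_lim (partial_y f) x y
    (partial_y (partial_x f) x y) (partial_y (partial_y f) x y).
Proof.
  intros Hf Hxy.
  assert (H1 : forall g u v, ex_diff_n g 1 u v ->
    continuity_2d_pt g u v /\ ex_derive (fun t => g t v) u /\ ex_derive (fun t => g u t) v /\
    continuity_2d_pt (partial_x g) u v /\ continuity_2d_pt (partial_y g) u v).
  { intros g u v [A1 [A2 [A3 [[A4 _] [A5 _]]]]]. now repeat split. }
  assert (H2 : forall u v, disk u v ->
    ex_derive (fun t => f t v) u /\ ex_derive (fun t => f u t) v /\
    ex_diff_n (partial_x f) 1 u v /\ ex_diff_n (partial_y f) 1 u v).
  { intros u v Huv. destruct (Hf u v Huv) as [_ [A1 [A2 [A3 A4]]]]. now repeat split. }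
  destruct (H2 x y Hxy) as [_ [Hy [Hfx Hfy]]].
  destruct (H1 _ _ _ Hfx) as [Cx [_ [Hxy' [Cxx Cyx]]]].
  destruct (H1 _ _ _ Hfy) as [_ [_ [Hyy [Cxy Cyy]]]].
  assert (Hsym : partial_x (partial_y f) x y = partial_y (partial_x f) x y).
  { apply (Schwarz f); [|exact Cxy | exact Cyx].
    apply locally_2d_disk; [|exact Hxy]. intros u v Huv.
    destruct (H2 u v Huv) as [A1 [A2 [A3 A4]]].
    destruct (H1 _ _ _ A3) as [_ [_ [A5 _]]]. destruct (H1 _ _ _ A4) as [_ [A6 _]].
    exact (conj A1 (conj A2 (conj A6 A5))). }
  split; [|split].
  - apply C1_differentiable_pt_lim; [|exact Hy | exact Cx].
    apply locally_2d_disk; [|exact Hxy]. intros u v Huv. exact (proj1 (H2 u v Huv)).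
  - apply C1_differentiable_pt_lim; [|exact Hxy' | exact Cxx].
    apply locally_2d_disk; [|exact Hxy]. intros u v Huv.
    destruct (H2 u v Huv) as [_ [_ [A _]]]. now apply H1 in A.
  - rewrite <- Hsym. apply C1_differentiable_pt_lim; [|exact Hyy | exact Cxy].
    apply locally_2d_disk; [|exact Hxy]. intros u v Huv.
    destruct (H2 u v Huv) as [_ [_ [_ A]]]. now apply H1 in A.
Qed.

Definition re_part (F : C -> C) (x y : R) : R := Re (F (x, y)).
Definition im_part (F : C -> C) (x y : R) : R := Im (F (x, y)).

(** In 4 d_z d_zbar the mixed derivatives cancel by symmetry and the pure ones add up. *)
Lemma laplacian_parts (F : C -> C) (x y : R) :
  C2_on_disk (re_part F) -> C2_on_disk (im_part F) -> disk x y ->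
  laplacian F (x, y) =
    (partial_x (partial_x (re_part F)) x y + partial_y (partial_y (re_part F)) x y,
     partial_x (partial_x (im_part F)) x y + partial_y (partial_y (im_part F)) x y).
Proof.
  intros Ha Hb Hxy.
  set (a := re_part F) in *. set (b := im_part F) in *.
  destruct (C2_on_disk_differentiable a x y Ha Hxy) as [_ [Hax Hay]].
  destruct (C2_on_disk_differentiable b x y Hb Hxy) as [_ [Hbx Hby]].
  assert (ER : forall u v, Re (d_zbar F (u, v)) = / 2 * (partial_x a u v - partial_y b u v)).
  { intros u v. unfold a, b, partial_x, partial_y, re_part, im_part, d_zbar, d_x, d_y, Ci, Re, Im.
    simpl. ring. }
  assert (EI : forall u v, Im (d_zbar F (u, v)) = / 2 * (partial_x b u v + partial_y a u v)).
  { intros u v. unfold a, b, partial_x, partial_y, re_part, im_part, d_zbar, d_x, d_y, Ci, Re, Im.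
    simpl. ring. }
  assert (HR : differentiable_pt_lim (fun u v => Re (d_zbar F (u, v))) x y
    (/ 2 * (partial_x (partial_x a) x y - partial_y (partial_x b) x y))
    (/ 2 * (partial_y (partial_x a) x y - partial_y (partial_y b) x y))).
  { apply (differentiable_pt_lim_ext (fun u v => / 2 * (partial_x a u v + - 1 * partial_y b u v))).
    - apply locally_2d_forall. intros u v. rewrite ER. ring.
    - eapply differentiable_pt_lim_eq.
      + apply differentiable_pt_lim_mult; [apply differentiable_pt_lim_const|].
        apply differentiable_pt_lim_plus; [exact Hax|].
        apply differentiable_pt_lim_mult; [apply differentiable_pt_lim_const | exact Hby].
      + cbv beta; ring.
      + cbv beta; ring. }
  assert (HI : differentiable_pt_lim (fun u v => Im (d_zbar F (u, v))) x y
    (/ 2 * (partial_x (partial_x b) x y + partial_y (partial_x a) x y))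
    (/ 2 * (partial_y (partial_x b) x y + partial_y (partial_y a) x y))).
  { apply (differentiable_pt_lim_ext (fun u v => / 2 * (partial_x b u v + partial_y a u v))).
    - apply locally_2d_forall. intros u v. now rewrite EI.
    - eapply differentiable_pt_lim_eq.
      + apply differentiable_pt_lim_mult; [apply differentiable_pt_lim_const|].
        apply differentiable_pt_lim_plus; [exact Hbx | exact Hay].
      + cbv beta; ring.
      + cbv beta; ring. }
  (* Uniqueness of the differential evaluates the [Derive] terms inside [d_z]. *)
  apply differentiable_pt_lim_unique in HR as [HR1 HR2].
  apply differentiable_pt_lim_unique in HI as [HI1 HI2].
  unfold laplacian, d_z, d_x at 1, d_y at 1.
  change (Re (x, y)) with x. change (Im (x, y)) with y.
  rewrite HR1, HR2, HI1, HI2.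
  unfold Cmult, Cminus, Cplus, Copp, RtoC, Ci; simpl. f_equal; field.
Qed.

Lemma harmonic_parts (F : C -> C) :
  harmonic F ->
  harmonic_on disk (re_part F) (partial_x (re_part F)) (partial_y (re_part F)) /\
  harmonic_on disk (im_part F) (partial_x (im_part F)) (partial_y (im_part F)).
Proof.
  intros [HC HL].
  assert (Ha : C2_on_disk (re_part F)).
  { intros x y H. apply (HC (x, y)), disk_unit_disk, H. }
  assert (Hb : C2_on_disk (im_part F)).
  { intros x y H. apply (HC (x, y)), disk_unit_disk, H. }
  assert (E : forall x y, disk x y ->
    partial_y (partial_y (re_part F)) x y = - partial_x (partial_x (re_part F)) x y /\
    partial_y (partial_y (im_part F)) x y = - partial_x (partial_x (im_part F)) x y).
  { intros x y H. assert (A := HL (x, y) (proj1 (disk_unit_disk x y) H)). simpl in A.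
    rewrite laplacian_parts in A by assumption. injection A as A1 A2. lra. }
  split; intros x y Hxy; destruct (E x y Hxy) as [E1 E2].
  - destruct (C2_on_disk_differentiable _ x y Ha Hxy) as [H1 [H2 H3]].
    split; [exact H1|]. do 2 eexists. split; [exact H2 | rewrite <- E1; exact H3].
  - destruct (C2_on_disk_differentiable _ x y Hb Hxy) as [H1 [H2 H3]].
    split; [exact H1|]. do 2 eexists. split; [exact H2 | rewrite <- E2; exact H3].
Qed.

Lemma harmonic_on_linear (D : R -> R -> Prop) (u ux uy v vx vy : R -> R -> R) (c s : R) :
  harmonic_on D u ux uy -> harmonic_on D v vx vy ->
  harmonic_on D (fun x y => c * u x y + s * v x y)
    (fun x y => c * ux x y + s * vx x y) (fun x y => c * uy x y + s * vy x y).
Proof.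
  assert (HL : forall f g x y fx fy gx gy,
    differentiable_pt_lim f x y fx fy -> differentiable_pt_lim g x y gx gy ->
    differentiable_pt_lim (fun x y => c * f x y + s * g x y) x y
      (c * fx + s * gx) (c * fy + s * gy)).
  { intros f g x y fx fy gx gy Hf Hg. eapply differentiable_pt_lim_eq.
    - apply differentiable_pt_lim_plus; apply differentiable_pt_lim_mult;
        apply differentiable_pt_lim_const || eassumption.
    - cbv beta; ring.
    - cbv beta; ring. }
  intros Hu Hv x y Hxy.
  destruct (Hu x y Hxy) as [Hu1 [a [b [Hux Huy]]]].
  destruct (Hv x y Hxy) as [Hv1 [a' [b' [Hvx Hvy]]]].
  split; [now apply HL|]. exists (c * a + s * a'), (c * b + s * b'). split.
  - now apply HL.
  - replace (- (c * a + s * a')) with (c * - a + s * - a') by ring. now apply HL.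
Qed.

(** * Real components and moduli *)

(** Cauchy-Schwarz, from (c a + s b)^2 + (c b - s a)^2 = (c^2 + s^2) (a^2 + b^2). *)
Lemma unit_combination_le (c s a b : R) (M : R) :
  c ^ 2 + s ^ 2 = 1 -> 0 <= M -> a ^ 2 + b ^ 2 <= M ^ 2 -> Rabs (c * a + s * b) <= M.
Proof.
  intros H HM Hab. apply Rsqr_incr_0_var; [|exact HM].
  rewrite <- Rsqr_abs, !Rsqr_pow2. apply Rle_trans with (2 := Hab).
  assert (0 <= (c * b - s * a) ^ 2) by apply pow2_ge_0. nra.
Qed.

(** Serves to pass from estimates of real components to moduli. At 0 any unit vector will do;
    elsewhere normalise (a, b). *)
Lemma exists_unit_combination (a b : R) :
  exists c s, c ^ 2 + s ^ 2 = 1 /\ c * a + s * b = Cmod (a, b).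
Proof.
  assert (H2 : Cmod (a, b) ^ 2 = a ^ 2 + b ^ 2).
  { unfold Cmod. simpl fst; simpl snd. apply pow2_sqrt. nra. }
  destruct (Req_dec (Cmod (a, b)) 0) as [H0|H0].
  - exists 1, 0. rewrite H0 in *. split; [ring|]. nra.
  - exists (a / Cmod (a, b)), (b / Cmod (a, b)). split.
    + field_simplify_eq; trivial. lra.
    + field_simplify_eq; trivial. lra.
Qed.

Lemma Cmod_sqr (z : C) : Cmod z ^ 2 = Re z ^ 2 + Im z ^ 2.
Proof.
  unfold Cmod. apply pow2_sqrt. apply Rplus_le_le_0_compat; apply pow2_ge_0.
Qed.

(** The terms with 2 x and 2 y come from the powers of |z|^2; they stand apart because they cancel
    in directions orthogonal to z. *)
Lemma radial_combination_differentiable (h hx hy g gx gy k kx ky : R -> R -> R) (x y : R) :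
  differentiable_pt_lim h x y (hx x y) (hy x y) ->
  differentiable_pt_lim g x y (gx x y) (gy x y) ->
  differentiable_pt_lim k x y (kx x y) (ky x y) ->
  let r := x ^ 2 + y ^ 2 in
  differentiable_pt_lim
    (fun x y => h x y + (x ^ 2 + y ^ 2) * g x y + (x ^ 2 + y ^ 2) ^ 2 * k x y) x y
    (hx x y + r * gx x y + r ^ 2 * kx x y + 2 * x * (g x y + 2 * r * k x y))
    (hy x y + r * gy x y + r ^ 2 * ky x y + 2 * y * (g x y + 2 * r * k x y)).
Proof.
  intros Hh Hg Hk r.
  assert (Hsq : forall f fx fy, differentiable_pt_lim f x y fx fy ->
    differentiable_pt_lim (fun x y => f x y ^ 2) x y (2 * f x y * fx) (2 * f x y * fy)).
  { intros f fx fy H. apply (differentiable_pt_lim_comp_1d (fun t => t ^ 2)); trivial.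
    apply is_derive_Reals. auto_derive; trivial. ring. }
  assert (Hr : differentiable_pt_lim (fun x y => x ^ 2 + y ^ 2) x y (2 * x) (2 * y)).
  { eapply differentiable_pt_lim_eq.
    - apply differentiable_pt_lim_plus; apply Hsq;
        [apply differentiable_pt_lim_fst | apply differentiable_pt_lim_snd].
    - cbv beta; ring.
    - cbv beta; ring. }
  eapply differentiable_pt_lim_eq.
  - apply differentiable_pt_lim_plus; [apply differentiable_pt_lim_plus; [exact Hh|]|].
    + apply differentiable_pt_lim_mult; [exact Hr | exact Hg].
    + apply differentiable_pt_lim_mult; [exact (Hsq _ _ _ Hr) | exact Hk].
  - unfold r. cbv beta. ring.
  - unfold r. cbv beta. ring.
Qed.

(** * Distances and the Bloch constant *)

(* The path is the hyperbolic geodesic [t |-> (z + t zeta) / (1 + conj z t zeta)],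
   [zeta = (w - z) / (1 - conj z w)], along which hyperbolic length is
   [artanh (t |zeta|)]. *)
Lemma difference_le_artanh (U Ux Uy : R -> R -> R) (C x0 y0 x1 y1 m : R) :
  (forall x y, disk x y -> differentiable_pt_lim U x y (Ux x y) (Uy x y)) ->
  (forall x y e1 e2, disk x y -> e1 ^ 2 + e2 ^ 2 = 1 ->
     (1 - (x ^ 2 + y ^ 2)) * (Ux x y * e1 + Uy x y * e2) <= C) ->
  disk x0 y0 -> disk x1 y1 -> 0 < m ->
  m ^ 2 * ((1 - (x0 * x1 + y0 * y1)) ^ 2 + (x0 * y1 - y0 * x1) ^ 2) =
    (x0 - x1) ^ 2 + (y0 - y1) ^ 2 ->
  m < 1 /\ U x1 y1 - U x0 y0 <= C * (1 / 2 * ln ((1 + m) / (1 - m))).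
Proof.
  intros HU HC Hz Hw Hm Em. unfold disk in Hz, Hw.
  (* k1 + i k2 = conj z w and Q = |1 - conj z w|^2 = |z - w|^2 + (1 - |z|^2) (1 - |w|^2), which
     forces m < 1. *)
  set (k1 := x0 * x1 + y0 * y1) in Em. set (k2 := x0 * y1 - y0 * x1) in Em.
  set (Q := (1 - k1) ^ 2 + k2 ^ 2) in Em.
  assert (Hr0 : 0 <= x0 ^ 2 + y0 ^ 2) by nra.
  assert (EQ : Q = (x0 - x1) ^ 2 + (y0 - y1) ^ 2 +
    (1 - (x0 ^ 2 + y0 ^ 2)) * (1 - (x1 ^ 2 + y1 ^ 2))) by (unfold Q, k1, k2; ring).
  assert (HQ1 : 0 < (1 - (x0 ^ 2 + y0 ^ 2)) * (1 - (x1 ^ 2 + y1 ^ 2)))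
    by (apply Rmult_lt_0_compat; lra).
  assert (HQ : 0 < Q).
  { assert (0 <= (x0 - x1) ^ 2) by apply pow2_ge_0.
    assert (0 <= (y0 - y1) ^ 2) by apply pow2_ge_0. lra. }
  assert (Hm1 : m < 1).
  { assert (m ^ 2 < 1) by (apply Rmult_lt_reg_r with Q; lra). nra. }
  split; [exact Hm1|].
  (* s1 + i s2 is zeta, with its denominator made real. *)
  set (s1 := ((x1 - x0) * (1 - k1) - (y1 - y0) * k2) / Q).
  set (s2 := ((x1 - x0) * k2 + (y1 - y0) * (1 - k1)) / Q).
  assert (Es : s1 ^ 2 + s2 ^ 2 = m ^ 2).
  { apply Rmult_eq_reg_r with Q; [|lra]. rewrite Em. unfold s1, s2.
    field_simplify_eq; [|lra]. unfold Q. ring. }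
  (* t1 + i t2 = conj z zeta, Dn t = |1 + t conj z zeta|^2, and p + i q is the geodesic. *)
  set (t1 := x0 * s1 + y0 * s2). set (t2 := x0 * s2 - y0 * s1).
  set (Dn := fun t => (1 + t * t1) ^ 2 + (t * t2) ^ 2).
  set (p := fun t => ((x0 + t * s1) * (1 + t * t1) + (y0 + t * s2) * (t * t2)) / Dn t).
  set (q := fun t => ((y0 + t * s2) * (1 + t * t1) - (x0 + t * s1) * (t * t2)) / Dn t).
  assert (Ht : t1 ^ 2 + t2 ^ 2 < 1).
  { replace (t1 ^ 2 + t2 ^ 2) with ((x0 ^ 2 + y0 ^ 2) * (s1 ^ 2 + s2 ^ 2))
      by (unfold t1, t2; ring). rewrite Es. nra. }
  assert (HD : forall t, 0 <= t <= 1 -> 0 < Dn t).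
  { intros t Htt. unfold Dn. assert (- 1 < t1) by nra.
    assert (0 < 1 + t * t1) by (destruct (Rle_dec 0 t1); nra). assert (0 <= (t * t2) ^ 2) by apply pow2_ge_0.
    assert (0 < (1 + t * t1) ^ 2) by (apply pow_lt; lra). lra. }
  assert (Epq : forall t, 0 <= t <= 1 -> 1 - (p t ^ 2 + q t ^ 2) =
     (1 - (x0 ^ 2 + y0 ^ 2)) * (1 - t ^ 2 * m ^ 2) / Dn t).
  { intros t Htt. assert (A := HD t Htt). rewrite <- Es. unfold p, q.
    field_simplify_eq; [|lra]. unfold Dn, t1, t2. ring. }
  assert (Htm : forall t, 0 <= t <= 1 -> 0 <= t * m < 1) by (intros; nra).
  assert (Hpq : forall t, 0 <= t <= 1 -> disk (p t) (q t)).
  { intros t Htt. unfold disk. apply Rlt_0_minus. rewrite Epq by assumption.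
    assert (A := Htm t Htt).
    apply Rdiv_lt_0_compat; [|now apply HD]. apply Rmult_lt_0_compat; [lra|].
    replace (t ^ 2 * m ^ 2) with ((t * m) ^ 2) by ring. nra. }
  (* p' + i q' = (1 - |z|^2) zeta / (1 + t conj z zeta)^2. *)
  set (l := fun t => (1 - (x0 ^ 2 + y0 ^ 2)) / (Dn t ^ 2)).
  set (p' := fun t => l t * (s1 * ((1 + t * t1) ^ 2 - (t * t2) ^ 2) + s2 * (2 * (t * t2) * (1 + t * t1)))).
  set (q' := fun t => l t * (s2 * ((1 + t * t1) ^ 2 - (t * t2) ^ 2) - s1 * (2 * (t * t2) * (1 + t * t1)))).
  assert (Hp' : forall t, 0 <= t <= 1 -> derivable_pt_lim p t (p' t)).
  { intros t Htt. assert (A := HD t Htt). apply is_derive_Reals. unfold p, p', l, Dn in *.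
    auto_derive; [lra|]. unfold t1, t2 in *. field. lra. }
  assert (Hq' : forall t, 0 <= t <= 1 -> derivable_pt_lim q t (q' t)).
  { intros t Htt. assert (A := HD t Htt). apply is_derive_Reals. unfold q, q', l, Dn in *.
    auto_derive; [lra|]. unfold t1, t2 in *. field. lra. }
  assert (Hspeed : forall t, 0 <= t <= 1 ->
     Ux (p t) (q t) * p' t + Uy (p t) (q t) * q' t <= C * (m / (1 - (t * m) ^ 2))).
  { intros t Htt. assert (A := HD t Htt). assert (B := Htm t Htt).
    (* The Euclidean speed; divided by 1 - p^2 - q^2 it becomes m / (1 - (t m)^2), the derivative of
       artanh (t m). *)
    set (v := (1 - (x0 ^ 2 + y0 ^ 2)) * m / Dn t).
    assert (Hv : 0 < v) by (apply Rdiv_lt_0_compat; [apply Rmult_lt_0_compat|]; lra).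
    assert (Ev : p' t ^ 2 + q' t ^ 2 = v ^ 2).
    { replace (v ^ 2) with ((1 - (x0 ^ 2 + y0 ^ 2)) ^ 2 * (s1 ^ 2 + s2 ^ 2) / Dn t ^ 2)
        by (rewrite Es; unfold v; field; lra).
      unfold p', q', l.
      field_simplify_eq; [|lra]. unfold Dn. ring. }
    assert (H := HC (p t) (q t) (p' t / v) (q' t / v) (Hpq t Htt)).
    rewrite Epq in H by assumption.
    assert (Ee : (p' t / v) ^ 2 + (q' t / v) ^ 2 = 1) by (field_simplify_eq; lra).
    specialize (H Ee).
    assert (Hf : 0 < 1 - (t * m) ^ 2) by nra.
    apply Rmult_le_reg_r with ((1 - (t * m) ^ 2) / m); [apply Rdiv_lt_0_compat; lra|].
    replace (C * (m / (1 - (t * m) ^ 2)) * ((1 - (t * m) ^ 2) / m)) with C by (field; lra).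
    apply Rle_trans with (2 := H). apply Req_le.
    unfold v. field. repeat split; lra. }
  set (phi := fun t => U (p t) (q t) - C * (1 / 2 * ln ((1 + t * m) / (1 - t * m)))).
  assert (Hphi : forall t, 0 <= t <= 1 -> derivable_pt_lim phi t
     (Ux (p t) (q t) * p' t + Uy (p t) (q t) * q' t - C * (m / (1 - (t * m) ^ 2)))).
  { intros t Htt. assert (B := Htm t Htt). apply derivable_pt_lim_minus.
    - apply derivable_pt_lim_comp_2d; auto.
    - apply is_derive_Reals. auto_derive.
      + repeat split; try lra. apply Rdiv_lt_0_compat; lra.
      + field. repeat split; nra. }
  destruct (MVT_cor2 phi _ 0 1 Rlt_0_1 Hphi) as [c [Ec Hc]].
  assert (S := Hspeed c ltac:(lra)).
  assert (Hle : phi 1 <= phi 0) by nra.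
  assert (E0 : p 0 = x0 /\ q 0 = y0).
  { unfold p, q, Dn. split; field. }
  assert (E1 : p 1 = x1 /\ q 1 = y1).
  { assert (A := HD 1 ltac:(lra)).
    assert (F1 : s1 * (1 - k1) + s2 * k2 = x1 - x0).
    { unfold s1, s2. field_simplify_eq; [|lra]. unfold Q. ring. }
    assert (F2 : s2 * (1 - k1) - s1 * k2 = y1 - y0).
    { unfold s1, s2. field_simplify_eq; [|lra]. unfold Q. ring. }
    (* z + zeta = w (1 + conj z zeta), a rearrangement of zeta (1 - conj z w) = w - z. *)
    assert (G1 : x0 + 1 * s1 = x1 * (1 + 1 * t1) - y1 * (1 * t2)).
    { unfold t1, t2, k1, k2 in *. lra. }
    assert (G2 : y0 + 1 * s2 = y1 * (1 + 1 * t1) + x1 * (1 * t2)).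
    { unfold t1, t2, k1, k2 in *. lra. }
    unfold p, q. rewrite G1, G2. unfold Dn in *. split; field; lra. }
  unfold phi in Hle. destruct E0 as [E0 E0']. destruct E1 as [E1 E1'].
  rewrite E0, E0', E1, E1', Rmult_0_l, Rplus_0_r, Rminus_0_r, Rdiv_1_r, ln_1, Rmult_1_l in Hle. lra.
Qed.

(** The quotient is squared and cleared of its denominator, the form in which [difference_le_artanh]
    takes [m]. *)
Lemma pseudo_hyperbolic_sqr (x0 y0 x1 y1 m : R) :
  disk x0 y0 -> disk x1 y1 ->
  m = Cmod (((x0, y0) - (x1, y1)) / (1 - Cconj (x0, y0) * (x1, y1)))%C ->
  0 <= m /\
  m ^ 2 * ((1 - (x0 * x1 + y0 * y1)) ^ 2 + (x0 * y1 - y0 * x1) ^ 2) =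
    (x0 - x1) ^ 2 + (y0 - y1) ^ 2 /\
  0 < (1 - (x0 * x1 + y0 * y1)) ^ 2 + (x0 * y1 - y0 * x1) ^ 2.
Proof.
  intros H0 H1 ->. split; [apply Cmod_ge_0|]. unfold disk in *.
  assert (HQ : 0 < (1 - (x0 * x1 + y0 * y1)) ^ 2 + (x0 * y1 - y0 * x1) ^ 2).
  { assert (0 <= (x0 - x1) ^ 2) by apply pow2_ge_0.
    assert (0 <= (y0 - y1) ^ 2) by apply pow2_ge_0.
    assert (0 < (1 - (x0 ^ 2 + y0 ^ 2)) * (1 - (x1 ^ 2 + y1 ^ 2)))
      by (apply Rmult_lt_0_compat; lra). lra. }
  split; [|exact HQ].
  set (b := (1 - Cconj (x0, y0) * (x1, y1))%C).
  assert (Eb : Cmod b ^ 2 = (1 - (x0 * x1 + y0 * y1)) ^ 2 + (x0 * y1 - y0 * x1) ^ 2).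
  { rewrite Cmod_sqr. unfold b, Cconj, Re, Im. simpl. ring. }
  rewrite <- Eb in HQ |- *.
  assert (Hb : b <> 0).
  { intro E. rewrite E, Cmod_0 in HQ. lra. }
  rewrite Cmod_div by exact Hb.
  replace ((Cmod ((x0, y0) - (x1, y1)) / Cmod b) ^ 2 * Cmod b ^ 2)
    with (Cmod ((x0, y0) - (x1, y1)) ^ 2).
  - rewrite Cmod_sqr. unfold Re, Im. simpl. ring.
  - field. intro E. rewrite E in HQ. lra.
Qed.

Lemma rho_pos (x0 y0 x1 y1 : R) :
  disk x0 y0 -> disk x1 y1 -> (x0, y0) <> (x1, y1) -> 0 < rho (x0, y0) (x1, y1).
Proof.
  intros H0 H1 Hne. unfold rho.
  set (m := Cmod _).
  destruct (pseudo_hyperbolic_sqr x0 y0 x1 y1 m H0 H1 eq_refl) as [Hm [Em HQ]].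
  assert (Hd : 0 < (x0 - x1) ^ 2 + (y0 - y1) ^ 2).
  { assert (0 <= (x0 - x1) ^ 2) by apply pow2_ge_0.
    assert (0 <= (y0 - y1) ^ 2) by apply pow2_ge_0.
    destruct (Req_dec x0 x1) as [Ex|Ex].
    - destruct (Req_dec y0 y1) as [Ey|Ey]; [now subst|].
      assert (0 < (y0 - y1) ^ 2) by (apply pow2_gt_0; lra). lra.
    - assert (0 < (x0 - x1) ^ 2) by (apply pow2_gt_0; lra). lra. }
  assert (Hm0 : 0 < m) by (destruct Hm as [|Hm]; [assumption | rewrite <- Hm in Em; lra]).
  (* Applied to the zero function for the sake of its conclusion m < 1. *)
  destruct (difference_le_artanh (fun _ _ => 0) (fun _ _ => 0) (fun _ _ => 0) 0
    x0 y0 x1 y1 m) as [Hm1 _]; try assumption.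
  - intros. apply differentiable_pt_lim_const.
  - intros. lra.
  - apply Rmult_lt_0_compat; [lra|]. rewrite <- ln_1. apply ln_increasing; [lra|].
    apply Rlt_div_r; lra.
Qed.

(* The pseudo-hyperbolic distance from [z] to [z + t d] is
   [t / sqrt ((1 - r)^2 + t^2 r)] with [r = |z|^2], since [d] is orthogonal to [z]. *)
Lemma tangential_derivative_le (U : R -> R -> R) (ux uy B x y d1 d2 : R) :
  differentiable_pt_lim U x y ux uy -> disk x y ->
  (forall x1 y1, disk x1 y1 -> (x, y) <> (x1, y1) ->
     U x1 y1 - U x y <= B * rho (x, y) (x1, y1)) ->
  d1 ^ 2 + d2 ^ 2 = 1 -> x * d1 + y * d2 = 0 ->
  (1 - (x ^ 2 + y ^ 2)) * (ux * d1 + uy * d2) <= B.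
Proof.
  intros HU Hz HB Hd Ht.
  assert (Hz' := Hz). unfold disk in Hz'.
  set (r := x ^ 2 + y ^ 2) in *.
  assert (Hr : 0 <= r) by (unfold r; nra).
  set (sg := fun t => sqrt ((1 - r) ^ 2 + t ^ 2 * r)).
  assert (Hsg0 : sg 0 = 1 - r).
  { unfold sg. rewrite pow_i, Rmult_0_l, Rplus_0_r by apply Nat.lt_0_succ.
    apply sqrt_pow2. lra. }
  assert (Hpos : forall t, 0 < (1 - r) ^ 2 + t ^ 2 * r).
  { intro t. assert (0 < (1 - r) ^ 2) by (apply pow_lt; lra).
    assert (0 <= t ^ 2 * r) by (apply Rmult_le_pos; [apply pow2_ge_0 | lra]). lra. }
  assert (Hsgd : ex_derive sg 0).
  { unfold sg. auto_derive. specialize (Hpos 0). simpl in Hpos. repeat split. lra. }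
  set (art := fun t => 1 / 2 * ln ((1 + t / sg t) / (1 - t / sg t))).
  (* [art t] will be the distance [rho] from z to z + t d; its slope at 0 is the hyperbolic density
     at z. *)
  assert (Hart : is_derive art 0 (/ (1 - r))).
  { unfold art. auto_derive.
    - rewrite Hsg0. repeat split; trivial; try lra.
      rewrite Rmult_0_l, Ropp_0, Rplus_0_r, Rinv_1. lra.
    - rewrite Hsg0. field. lra. }
  destruct (disk_open x y Hz) as [[dl Hdl] Hopen]. simpl in Hopen.
  assert (Hd1 : Rabs d1 <= 1) by (apply Rabs_le; nra).
  assert (Hd2 : Rabs d2 <= 1) by (apply Rabs_le; nra).
  assert (HUd : is_derive (fun t => U (x + t * d1) (y + t * d2)) 0 (ux * d1 + uy * d2)).
  { apply is_derive_Reals.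
    apply (derivable_pt_lim_comp_2d U (fun t => x + t * d1) (fun t => y + t * d2)).
    - now rewrite !Rmult_0_l, !Rplus_0_r.
    - apply is_derive_Reals. auto_derive; [trivial | ring].
    - apply is_derive_Reals. auto_derive; [trivial | ring]. }
  assert (H : ux * d1 + uy * d2 - B * / (1 - r) <= 0).
  { apply (right_derivative_le_0 (fun t => U (x + t * d1) (y + t * d2) - B * art t) 0 _ dl Hdl).
    - apply @is_derive_minus; [exact HUd|]. now apply is_derive_scal.
    - intros t Htt. rewrite Rplus_0_l, !Rmult_0_l, !Rplus_0_r.
      assert (E0 : art 0 = 0).
      { unfold art. rewrite Rdiv_0_l, Rplus_0_r, Rminus_0_r, Rdiv_1_r, ln_1. ring. }
      rewrite E0.
      assert (Hw : disk (x + t * d1) (y + t * d2)).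
      { apply Hopen.
        - replace (x + t * d1 - x) with (t * d1) by ring.
          rewrite Rabs_mult, (Rabs_pos_eq t) by lra. nra.
        - replace (y + t * d2 - y) with (t * d2) by ring.
          rewrite Rabs_mult, (Rabs_pos_eq t) by lra. nra. }
      assert (Hne : (x, y) <> (x + t * d1, y + t * d2)).
      { intro E. injection E as Ex Ey.
        assert (t * d1 = 0) by lra. assert (t * d2 = 0) by lra.
        assert (t ^ 2 * (d1 ^ 2 + d2 ^ 2) = 0) by nra. nra. }
      assert (A := HB _ _ Hw Hne).
      replace (rho (x, y) (x + t * d1, y + t * d2)) with (art t) in A; [lra|].
      unfold rho, art. set (m := Cmod _).
      destruct (pseudo_hyperbolic_sqr _ _ _ _ m Hz Hw eq_refl) as [Hm [Em HQ]].
      replace (t / sg t) with m; [reflexivity|].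
      assert (Hs : 0 < sg t) by now apply sqrt_lt_R0.
      assert (Hs2 : sg t ^ 2 = (1 - r) ^ 2 + t ^ 2 * r) by (apply pow2_sqrt, Rlt_le, Hpos).
      (* By orthogonality conj z (z + t d) = r + i t (x d2 - y d1), and (x d2 - y d1)^2 = r. *)
      assert (EQ : (1 - (x * (x + t * d1) + y * (y + t * d2))) ^ 2 +
        (x * (y + t * d2) - y * (x + t * d1)) ^ 2 = (1 - r) ^ 2 + t ^ 2 * r).
      { replace (x * (x + t * d1) + y * (y + t * d2)) with (r + t * (x * d1 + y * d2))
          by (unfold r; ring).
        assert (E : (x * d2 - y * d1) ^ 2 = r).
        { replace ((x * d2 - y * d1) ^ 2) with (r * (d1 ^ 2 + d2 ^ 2) - (x * d1 + y * d2) ^ 2)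
            by (unfold r; ring). rewrite Hd, Ht. ring. }
        replace (x * (y + t * d2) - y * (x + t * d1)) with (t * (x * d2 - y * d1)) by ring.
        rewrite Ht, Rpow_mult_distr, E. ring. }
      rewrite EQ, <- Hs2 in Em.
      assert (E2 : (m * sg t) ^ 2 = t ^ 2).
      { rewrite Rpow_mult_distr, Em.
        replace ((x - (x + t * d1)) ^ 2 + (y - (y + t * d2)) ^ 2) with (t ^ 2 * (d1 ^ 2 + d2 ^ 2)) by ring.
        rewrite Hd. ring. }
      assert (0 <= m * sg t) by (apply Rmult_le_pos; lra).
      assert (E3 : m * sg t = t) by nra.
      rewrite <- E3 at 1. field. lra. }
  apply Rmult_le_reg_r with (/ (1 - r)); [apply Rinv_0_lt_compat; lra|].
  replace ((1 - r) * (ux * d1 + uy * d2) * / (1 - r)) with (ux * d1 + uy * d2) by (field; lra).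
  lra.
Qed.

(** * Components of the triharmonic mapping and their gradients *)

(** This is Re (conj e F) with e = c + i s. *)
Definition component (c s : R) (F : C -> C) (x y : R) : R :=
  c * re_part F x y + s * im_part F x y.

Definition component_x (c s : R) (F : C -> C) (x y : R) : R :=
  c * partial_x (re_part F) x y + s * partial_x (im_part F) x y.

Definition component_y (c s : R) (F : C -> C) (x y : R) : R :=
  c * partial_y (re_part F) x y + s * partial_y (im_part F) x y.

Lemma component_harmonic (c s : R) (F : C -> C) :
  harmonic F -> harmonic_on disk (component c s F) (component_x c s F) (component_y c s F).
Proof. intro HF. apply harmonic_on_linear; now apply harmonic_parts. Qed.

Lemma component_bound (c s M : R) (F : C -> C) (x y : R) :
  c ^ 2 + s ^ 2 = 1 -> Cmod (F (x, y)) <= M -> Rabs (component c s F x y) <= M.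
Proof.
  intros Hcs HM. assert (H0 := Cmod_ge_0 (F (x, y))).
  apply unit_combination_le; [exact Hcs | lra |].
  unfold re_part, im_part. rewrite <- Cmod_sqr. apply pow_incr. lra.
Qed.

Definition triharmonic_component (c s : R) (H G K : C -> C) (x y : R) : R :=
  component c s H x y + (x ^ 2 + y ^ 2) * component c s G x y
  + (x ^ 2 + y ^ 2) ^ 2 * component c s K x y.

(** [d] is [component_x] or [component_y] and [t] the matching coordinate; taking [t = 0] drops the
    radial term. *)
Definition triharmonic_component_d (d : R -> R -> (C -> C) -> R -> R -> R)
  (c s : R) (H G K : C -> C) (t x y : R) : R :=
  d c s H x y + (x ^ 2 + y ^ 2) * d c s G x y + (x ^ 2 + y ^ 2) ^ 2 * d c s K x y
  + 2 * t * (component c s G x y + 2 * (x ^ 2 + y ^ 2) * component c s K x y).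

Lemma triharmonic_component_differentiable (c s : R) (H G K : C -> C) (x y : R) :
  harmonic H -> harmonic G -> harmonic K -> disk x y ->
  differentiable_pt_lim (triharmonic_component c s H G K) x y
    (triharmonic_component_d component_x c s H G K x x y)
    (triharmonic_component_d component_y c s H G K y x y).
Proof.
  intros HH HG HK Hxy.
  apply (radial_combination_differentiable _ (component_x c s H) (component_y c s H)
    _ (component_x c s G) (component_y c s G) _ (component_x c s K) (component_y c s K));
  now apply component_harmonic.
Qed.

Lemma Cmod_pow2 (x y : R) : Cmod (x, y) ^ 2 = x ^ 2 + y ^ 2.
Proof. apply Cmod_sqr. Qed.

Lemma Cmod_pow4 (x y : R) : Cmod (x, y) ^ 4 = (x ^ 2 + y ^ 2) ^ 2.
Proof. rewrite <- Cmod_pow2. ring. Qed.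

Lemma triharmonic_component_eq (c s : R) (f H G K : C -> C) (x y : R) :
  f (x, y) = (H (x, y) + RtoC (Cmod (x, y) ^ 2) * G (x, y)
    + RtoC (Cmod (x, y) ^ 4) * K (x, y))%C ->
  triharmonic_component c s H G K x y = component c s f x y.
Proof.
  intro E. unfold triharmonic_component, component, re_part, im_part. rewrite E.
  rewrite Cmod_pow2, Cmod_pow4. unfold Re, Im. simpl. ring.
Qed.

(** The harmonic Schwarz bound handles the gradients of H, G and K. The radial term is at most 2 M q
    (1 - q^2) (1 + 2 q^2), and (1 - q^2) (1 + 2 q^2) = 1 + q^2 - 2 q^4. *)
Lemma triharmonic_component_gradient_le (c s M : R) (H G K : C -> C) (x y e1 e2 : R) :
  harmonic H -> harmonic G -> harmonic K -> 0 < M ->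
  (forall z, unit_disk z -> Cmod (H z) <= M /\ Cmod (G z) <= M /\ Cmod (K z) <= M) ->
  c ^ 2 + s ^ 2 = 1 -> disk x y -> e1 ^ 2 + e2 ^ 2 = 1 ->
  (1 - (x ^ 2 + y ^ 2)) *
    (triharmonic_component_d component_x c s H G K x x y * e1 +
     triharmonic_component_d component_y c s H G K y x y * e2) <=
  2 * M * phi3 (Cmod (x, y)).
Proof.
  intros HH HG HK M0 HM Hcs Hxy He.
  assert (S : forall F, harmonic F -> (forall z, unit_disk z -> Cmod (F z) <= M) ->
    (1 - (x ^ 2 + y ^ 2)) * (component_x c s F x y * e1 + component_y c s F x y * e2) <= 4 * M / PI
    /\ Rabs (component c s F x y) <= M).
  { intros F HF HFM. split.
    - apply (disk_derivative_le (component c s F)); try assumption.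
      + now apply component_harmonic.
      + intros x' y' Hxy'. apply component_bound; [exact Hcs|]. now apply HFM, disk_unit_disk.
    - apply component_bound; [exact Hcs|]. now apply HFM, disk_unit_disk. }
  destruct (S H HH (fun z Hz => proj1 (HM z Hz))) as [SH _].
  destruct (S G HG (fun z Hz => proj1 (proj2 (HM z Hz)))) as [SG BG].
  destruct (S K HK (fun z Hz => proj2 (proj2 (HM z Hz)))) as [SK BK].
  clear S. unfold disk in Hxy. unfold triharmonic_component_d.
  assert (Hrho := Cmod_ge_0 (x, y)). assert (Er := Cmod_pow2 x y).
  set (q := Cmod (x, y)) in *. rewrite <- Er in *.
  assert (Ht : Rabs (e1 * x + e2 * y) <= q) by (apply unit_combination_le; lra).
  set (g := component c s G x y) in *. set (k := component c s K x y) in *.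
  assert (Hgk : Rabs (g + 2 * q ^ 2 * k) <= M + 2 * q ^ 2 * M).
  { apply Rle_trans with (1 := Rabs_triang _ _).
    rewrite Rabs_mult, (Rabs_pos_eq (2 * q ^ 2)) by nra.
    apply Rplus_le_compat; [exact BG|]. apply Rmult_le_compat_l; [nra | exact BK]. }
  assert (Hprod : (e1 * x + e2 * y) * (g + 2 * q ^ 2 * k) <= q * (M + 2 * q ^ 2 * M)).
  { apply Rle_trans with (1 := Rle_abs _). rewrite Rabs_mult.
    apply Rmult_le_compat; trivial; apply Rabs_pos. }
  assert (Hprod' := Rmult_le_compat_l (1 - q ^ 2) _ _ ltac:(lra) Hprod).
  assert (SG' := Rmult_le_compat_l (q ^ 2) _ _ ltac:(nra) SG).
  assert (SK' := Rmult_le_compat_l ((q ^ 2) ^ 2) _ _ ltac:(nra) SK).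
  replace (2 * M * phi3 q) with
    (4 * M / PI + q ^ 2 * (4 * M / PI) + (q ^ 2) ^ 2 * (4 * M / PI)
     + 2 * ((1 - q ^ 2) * (q * (M + 2 * q ^ 2 * M)))).
  - lra.
  - unfold phi3. field. apply PI_neq0.
Qed.

(** Turn a unit vector along z by a right angle; at z = 0 any unit vector serves. *)
Lemma exists_tangent (x y : R) :
  exists d1 d2, d1 ^ 2 + d2 ^ 2 = 1 /\ x * d1 + y * d2 = 0.
Proof.
  destruct (exists_unit_combination x y) as [c [s [Hcs E]]].
  exists (- s), c. split; [lra|].
  assert (A := Cmod_pow2 x y). rewrite <- E in A.
  assert (B : (x * - s + y * c) ^ 2 = 0).
  { replace ((x * - s + y * c) ^ 2) with ((c ^ 2 + s ^ 2) * (x ^ 2 + y ^ 2) - (c * x + s * y) ^ 2) by ring.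
    rewrite Hcs. lra. }
  apply Rsqr_0_uniq. now rewrite Rsqr_pow2.
Qed.

(** Multiplication by d or conj d preserves moduli; what remains is the reverse triangle
    inequality. *)
Lemma Cmod_minus_le_Cmod_rotation (A B d : C) :
  Cmod d = 1 -> Rabs (Cmod A - Cmod B) <= Cmod (d * A + Cconj d * B)%C.
Proof.
  intro Hd.
  assert (EA : Cmod (d * A) = Cmod A) by (rewrite Cmod_mult, Hd; ring).
  assert (EB : Cmod (Cconj d * B) = Cmod B) by (rewrite Cmod_mult, Cmod_conj, Hd; ring).
  rewrite <- EA, <- EB. set (u := (d * A)%C). set (v := (Cconj d * B)%C).
  assert (H1 := Cmod_triangle (u + v) (- v)). assert (H2 := Cmod_triangle (u + v) (- u)).
  rewrite Cmod_opp in H1, H2.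
  replace (u + v + - v)%C with u in H1 by ring.
  replace (u + v + - u)%C with v in H2 by ring.
  apply Rabs_le. lra.
Qed.

Lemma wirtinger_le_bloch (f H G K : C -> C) (B : R) (z : C) :
  harmonic H -> harmonic G -> harmonic K ->
  (forall z, unit_disk z ->
     f z = (H z + RtoC (Cmod z ^ 2) * G z + RtoC (Cmod z ^ 4) * K z)%C) ->
  (forall z w, unit_disk z -> unit_disk w -> z <> w -> Cmod (f z - f w)%C <= B * rho z w) ->
  unit_disk z ->
  (1 - Cmod z ^ 2) *
    Rabs (Cmod (d_z H z + RtoC (Cmod z ^ 2) * d_z G z + RtoC (Cmod z ^ 4) * d_z K z)%C
          - Cmod (d_zbar H z + RtoC (Cmod z ^ 2) * d_zbar G z
                  + RtoC (Cmod z ^ 4) * d_zbar K z)%C) <= B.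
Proof.
  intros HH HG HK Hf HB Hz. destruct z as [x y].
  assert (Hxy := proj2 (disk_unit_disk x y) Hz).
  destruct (exists_tangent x y) as [d1 [d2 [Hd Ht]]].
  set (A := (d_z H (x, y) + _ + _)%C). set (A' := (d_zbar H (x, y) + _ + _)%C).
  assert (Hd1 : Cmod (d1, d2) = 1).
  { unfold Cmod. simpl fst; simpl snd. rewrite Hd. apply sqrt_1. }
  assert (HT := Cmod_minus_le_Cmod_rotation A A' (d1, d2) Hd1).
  (* [T] is the derivative of f at z in the tangential direction d; the component chosen next has
     derivative |T| there. *)
  set (T := ((d1, d2) * A + Cconj (d1, d2) * A')%C) in HT.
  destruct (exists_unit_combination (Re T) (Im T)) as [c [s [Hcs ET]]].
  replace (Re T, Im T) with T in ET by (now destruct T).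
  rewrite <- ET in HT.
  apply Rle_trans with ((1 - Cmod (x, y) ^ 2) * (c * Re T + s * Im T)).
  { apply Rmult_le_compat_l; [|exact HT]. rewrite Cmod_pow2. unfold disk in Hxy. lra. }
  rewrite Cmod_pow2.
  assert (Hdiff : forall x1 y1, disk x1 y1 -> (x, y) <> (x1, y1) ->
    triharmonic_component c s H G K x1 y1 - triharmonic_component c s H G K x y
      <= B * rho (x, y) (x1, y1)).
  { intros x1 y1 H1 Hne. apply disk_unit_disk in H1.
    rewrite !(triharmonic_component_eq c s f) by now apply Hf.
    apply Rle_trans with (2 := HB _ _ Hz H1 Hne).
    replace (Cmod (f (x, y) - f (x1, y1))%C) with (Cmod (f (x1, y1) - f (x, y))%C)
      by (rewrite <- Cmod_opp; f_equal; ring).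
    apply Rle_trans with (1 := Rle_abs _).
    (* The increment is read as the component of a constant function, so that [component_bound]
       applies. *)
    replace (component c s f x1 y1 - component c s f x y)
      with (component c s (fun _ => f (x1, y1) - f (x, y))%C 0 0)
      by (unfold component, re_part, im_part, Re, Im; simpl; ring).
    apply component_bound; [exact Hcs | apply Rle_refl]. }
  assert (L := tangential_derivative_le _ _ _ B x y d1 d2
    (triharmonic_component_differentiable c s H G K x y HH HG HK Hxy) Hxy).
  apply Rle_trans with (2 := L Hdiff Hd Ht).
  apply Req_le. f_equal.
  (* Splits off the radial part, a multiple of x d1 + y d2 = 0. *)
  replace (triharmonic_component_d component_x c s H G K x x y * d1
     + triharmonic_component_d component_y c s H G K y x y * d2)
  with (triharmonic_component_d component_x c s H G K 0 x y * d1
     + triharmonic_component_d component_y c s H G K 0 x y * d2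
     + 2 * (x * d1 + y * d2) * (component c s G x y + 2 * (x ^ 2 + y ^ 2) * component c s K x y))
  by (unfold triharmonic_component_d; ring).
  rewrite Ht. unfold T, A, A', triharmonic_component_d, component_x, component_y, d_z, d_zbar.
  rewrite Cmod_pow2, Cmod_pow4.
  assert (EX : forall F, d_x F (x, y) = (partial_x (re_part F) x y, partial_x (im_part F) x y))
    by reflexivity.
  assert (EY : forall F, d_y F (x, y) = (partial_y (re_part F) x y, partial_y (im_part F) x y))
    by reflexivity.
  rewrite !EX, !EY. unfold Re, Im, Cconj, Ci. simpl. field.
Qed.

Lemma bloch_quotient_le (f H G K : C -> C) (M L : R) (z w : C) :
  harmonic H -> harmonic G -> harmonic K -> 0 < M ->
  (forall z, unit_disk z ->
     f z = (H z + RtoC (Cmod z ^ 2) * G z + RtoC (Cmod z ^ 4) * K z)%C) ->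
  (forall z, unit_disk z -> Cmod (H z) <= M /\ Cmod (G z) <= M /\ Cmod (K z) <= M) ->
  (forall t, 0 <= t <= 1 -> 2 * M * phi3 t <= L) ->
  unit_disk z -> unit_disk w -> z <> w ->
  Cmod (f z - f w)%C / rho z w <= L.
Proof.
  intros HH HG HK M0 Hf HM HC Hz Hw Hne.
  destruct z as [x0 y0]. destruct w as [x1 y1].
  assert (Hz' := proj2 (disk_unit_disk _ _) Hz). assert (Hw' := proj2 (disk_unit_disk _ _) Hw).
  assert (Hr := rho_pos x0 y0 x1 y1 Hz' Hw' Hne).
  apply Rle_div_l; [exact Hr|].
  replace (Cmod (f (x0, y0) - f (x1, y1))%C) with (Cmod (f (x1, y1) - f (x0, y0))%C)
    by (rewrite <- Cmod_opp; f_equal; ring).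
  set (v := (f (x1, y1) - f (x0, y0))%C).
  (* In this direction the increment of the real component equals |f w - f z|. *)
  destruct (exists_unit_combination (Re v) (Im v)) as [c [s [Hcs Ev]]].
  replace (Re v, Im v) with v in Ev by (now destruct v). rewrite <- Ev.
  set (m := Cmod (((x0, y0) - (x1, y1)) / (1 - Cconj (x0, y0) * (x1, y1)))%C).
  destruct (pseudo_hyperbolic_sqr x0 y0 x1 y1 m Hz' Hw' eq_refl) as [Hm [Em HQ]].
  assert (Hm0 : 0 < m).
  { destruct Hm as [Hm|Hm]; [exact Hm|]. exfalso. apply Rlt_not_eq in Hr. apply Hr.
    unfold rho. fold m. rewrite <- Hm, Rplus_0_r, Rminus_0_r, Rdiv_1_r, ln_1. ring. }
  destruct (difference_le_artanh (triharmonic_component c s H G K)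
    (fun x y => triharmonic_component_d component_x c s H G K x x y)
    (fun x y => triharmonic_component_d component_y c s H G K y x y) L x0 y0 x1 y1 m)
    as [_ HL]; try assumption.
  - intros x y Hxy. now apply triharmonic_component_differentiable.
  - intros x y e1 e2 Hxy He.
    apply Rle_trans with (2 * M * phi3 (Cmod (x, y))).
    + now apply triharmonic_component_gradient_le.
    + apply HC. split; [apply Cmod_ge_0|]. now apply Rlt_le, disk_unit_disk.
  - rewrite !(triharmonic_component_eq c s f) in HL by now apply Hf.
    apply Rle_trans with (2 := HL). apply Req_le.
    unfold component, re_part, im_part, v, Re, Im. simpl. ring.
Qed.

(** * The maximal value of [phi3] and the two bounds for the Bloch constant *)

Theorem corollary4 :
  exists y1 : R,
    0 < y1 < 1 /\
    is_lub (fun r : R => exists y : R, 0 < y < 1 /\ r = phi3 y) (phi3 y1) /\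
    Rabs (2 * phi3 y1 - 4.037006) < 1 / 10 ^ 6 /\
    forall f H G K : C -> C,
      triharmonic f ->
      harmonic H -> harmonic G -> harmonic K ->
      (forall z : C, unit_disk z ->
         f z = (H z + RtoC (Cmod z ^ 2) * G z + RtoC (Cmod z ^ 4) * K z)%C) ->
      Rbar_lt (bloch_constant f) p_infty ->
      Rbar_le
        (Lub_Rbar (fun r : R => exists z : C, unit_disk z /\
           r = (1 - Cmod z ^ 2) *
               Rabs
                 (Cmod (d_z H z + RtoC (Cmod z ^ 2) * d_z G z
                        + RtoC (Cmod z ^ 4) * d_z K z)%C
                  - Cmod (d_zbar H z + RtoC (Cmod z ^ 2) * d_zbar G z
                          + RtoC (Cmod z ^ 4) * d_zbar K z)%C)))
        (bloch_constant f)
      /\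
      forall M : R,
        0 < M ->
        (forall z : C, unit_disk z ->
           Cmod (H z) <= M /\ Cmod (G z) <= M /\ Cmod (K z) <= M) ->
        Rbar_le (bloch_constant f) (Finite (2 * M * phi3 y1)).
Proof.
  destruct phi3_max as [y1 [Hy1 Hmax]]. exists y1.
  split; [exact Hy1|]. split; [|split].
  - split.
    + intros r [y [Hy ->]]. apply Hmax. lra.
    + intros b Hb. apply Hb. now exists y1.
  - assert (A := Rlt_le_trans _ _ _ phi3_gt (Hmax 0.891951 ltac:(lra))).
    assert (B := phi3_lt y1 ltac:(lra)). apply Rabs_def1; lra.
  - intros f H G K _ HH HG HK Hf HB. split.
    + unfold bloch_constant in *.
      set (Q := fun r => exists z w : C, unit_disk z /\ unit_disk w /\ z <> w /\
        r = Cmod (f z - f w)%C / rho z w) in *.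
      destruct (Lub_Rbar_correct Q) as [Hub _].
      apply Lub_Rbar_correct. intros r [z [Hz ->]].
      (* Plus infinity is excluded by [HB]; minus infinity because the points 0 and 1 / 2 show that
         the set of quotients is nonempty. *)
      destruct (Lub_Rbar Q) as [B| |]; [|easy|].
      * apply (wirtinger_le_bloch f H G K B z); try assumption.
        intros z' w' Hz' Hw' Hne.
        assert (Hr : 0 < rho z' w').
        { destruct z', w'. apply rho_pos; try apply disk_unit_disk; assumption. }
        apply Rle_div_l; [exact Hr|].
        apply (Hub (Cmod (f z' - f w')%C / rho z' w')). now exists z', w'.
      * exfalso.
        apply (Hub (Cmod (f (RtoC 0) - f (RtoC (/ 2)))%C / rho (RtoC 0) (RtoC (/ 2)))).
        exists (RtoC 0), (RtoC (/ 2)).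
        split; [|split; [|split]]; try apply disk_unit_disk; unfold disk; try lra; trivial.
        intro E. injection E. lra.
    + intros M M0 HM. apply Lub_Rbar_correct. intros r [z [w [Hz [Hw [Hne ->]]]]].
      apply (bloch_quotient_le f H G K M); try assumption.
      intros t Ht. apply Rmult_le_compat_l; [lra|]. now apply Hmax.
Qed.
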